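(* There exist a family of graphs and a constant $c>0$ such that for every $\varepsilon\in(0,1)$, $n\in\mathbb{N}$, $\alpha\in(0,n^2]$ and $\delta\in\left[0,\frac{1}{10^5}\cdot\frac{\varepsilon^3\alpha^2}{n^5\ln(n^3/(\varepsilon\alpha))}\right]$, every (potentially interactive) $(\varepsilon,\delta)$-LEDP algorithm that gets an $n$-node graph from the family as input and approximates the number of triangles in the graph with additive error at most $\alpha$ with probability at least $2/3$ must have $\alpha\ge c\cdot\frac{n^{3/2}}{\varepsilon}$.
   Context: Local edge model: the input is an undirected graph $G=([n],E)$; node $i$ holds its row of the adjacency matrix. An $(\varepsilon,\delta)$-local randomizer is a randomized map $R:\{0,1\}^n\to\mathcal{Y}$ with $\Pr[R(\mathbf{a})\in Y]\le e^{\varepsilon}\Pr[R(\mathbf{a}')\in Y]+\delta$ for all $\mathbf{a},\mathbf{a}'$ differing in one bit. An interactive local algorithm proceeds in any number of rounds; in each round, based on the transcript so far, it chooses a set of parties and assigns each a local randomizer (with privacy parameters), which the party runs on its adjacency vector, and the outputs are appended to the transcript. The algorithm is $(\varepsilon,\delta)$-LEDP if the map from $G$ to the entire transcript is $(\varepsilon,\delta)$-differentially private with respect to graphs differing in exactly one edge.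
   Formalization: The formal theorem assumes n ≥ 15: for 1 ≤ n ≤ 14 the claim fails, since always answering C(n,3)/2 is (ε,0)-LEDP for every ε with error at most n² = α, while c·n^{3/2}/ε is unbounded as ε → 0. *)

(* Defs.v *)
From HB Require Import structures.
From mathcomp Require Import all_boot all_order all_algebra.
From mathcomp Require Import all_classical all_reals all_analysis.
From mathcomp Require Import measurable_realfun.

Set Implicit Arguments.
Unset Strict Implicit.
Unset Printing Implicit Defensive.

Import Order.TTheory GRing.Theory Num.Theory.
Import numFieldNormedType.Exports.

Local Open Scope classical_set_scope.
Local Open Scope ring_scope.

Record graph (n : nat) := Graph {
  adj : rel 'I_n;
  adj_sym : symmetric adj;
  adj_irr : irreflexive adj }.

Definition adj_row (n : nat) (G : graph n) (i : 'I_n) : {ffun 'I_n -> bool} :=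
  [ffun j => adj G i j].

Definition edge_neighbors (n : nat) (G G' : graph n) : Prop :=
  #|[pred e : 'I_n * 'I_n | (e.1 < e.2)%N && (adj G e.1 e.2 != adj G' e.1 e.2)]|
  = 1%N.

Definition triangles (n : nat) (G : graph n) : nat :=
  #|[pred T : {set 'I_n} |
      (#|T| == 3%N) && [forall i in T, forall j in T, (i != j) ==> adj G i j]]|.

Definition is_local_randomizer (R : realType) (n : nat) d (Y : measurableType d)
    (eps delta : R) (f : {ffun 'I_n -> bool} -> probability Y R) : Prop :=
  forall a a' : {ffun 'I_n -> bool}, #|[pred j | a j != a' j]| = 1%N ->
  forall U : set Y, measurable U ->
    (f a U <= (expR eps)%:E * f a' U + delta%:E)%E.

Record local_randomizer (R : realType) (n : nat) d (Y : measurableType d) :=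
  LocalRandomizer {
    lr_eps : R;
    lr_delta : R;
    lr_fun : {ffun 'I_n -> bool} -> probability Y R;
    lr_eps_ge0 : 0 <= lr_eps;
    lr_delta_ge0 : 0 <= lr_delta;
    lr_private : is_local_randomizer lr_eps lr_delta lr_fun }.

(* [randomizers i] is used only when [i \in parties]. *)
Record round (R : realType) (n : nat) d (Y : measurableType d) := Round {
  parties : {set 'I_n};
  randomizers : 'I_n -> local_randomizer R n Y }.

(* A transcript lists, round by round, the outputs of all [n] parties; a party
   that is not selected in a round contributes the placeholder [point].  The
   other data of a round (parties, randomizers and their privacy parameters)
   are a function of the preceding outputs, so they are not repeated. *)
Definition transcript (n : nat) d (Y : measurableType d) : Type :=
  seq (n.-tuple Y).

Definition transcript_display : measure_display -> measure_display.
Proof. exact. Qed.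

Section transcript_measurable.
Context (n : nat) d (Y : measurableType d).

(* The disjoint union, over [k], of the product sigma-algebras on transcripts
   of [k] rounds. *)
Definition transcript_measurable : set (set (transcript n Y)) :=
  [set E | forall k : nat,
     measurable [set t : k.-tuple (n.-tuple Y) | E (tval t)]].

Let transcript_measurable0 : transcript_measurable set0.
Proof. by move=> k; exact: measurable0. Qed.

Let transcript_measurableC E :
  transcript_measurable E -> transcript_measurable (~` E).
Proof. by move=> mE k; exact: (measurableC (mE k)). Qed.

Let transcript_measurable_bigcup (F : (set (transcript n Y))^nat) :
  (forall i, transcript_measurable (F i)) ->
  transcript_measurable (\bigcup_i F i).
Proof.
move=> mF k; have := bigcup_measurable (fun i (_ : True) => mF i k).
by congr measurable; apply/seteqP; split => t /=; case=> i; exists i.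
Qed.

HB.instance Definition _ := Choice.on (transcript n Y).
HB.instance Definition _ := isPointed.Build (transcript n Y) [::].
HB.instance Definition _ := @isMeasurable.Build (transcript_display d)
  (transcript n Y) transcript_measurable
  transcript_measurable0 transcript_measurableC transcript_measurable_bigcup.

End transcript_measurable.

Definition output_law (R : realType) (n : nat) d (Y : measurableType d)
    (r : option (round R n Y)) (i : 'I_n) (a : {ffun 'I_n -> bool}) :
    probability Y R :=
  if r is Some r then
    if i \in parties r then lr_fun (randomizers r i) a else dirac point
  else dirac point.

(* [next_round h = None] means that the algorithm halts with transcript [h].  The
   last two fields make the sequential experiment of [run_prob] a well-defined
   process when [Y] is not discrete. *)
Record local_algorithm (R : realType) (n : nat) d (Y : measurableType d) :=
  LocalAlgorithm {
    next_round : transcript n Y -> option (round R n Y);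
    measurable_halt : measurable [set h | next_round h = None];
    measurable_output_law : forall (i : 'I_n) (a : {ffun 'I_n -> bool})
        (U : set Y), measurable U ->
      measurable_fun setT (fun h => output_law (next_round h) i a U) }.

(* The integral of [f] against the product of the laws [mu i]: the parties use
   independent random coins. *)
Fixpoint product_integral (R : realType) d (Y : measurableType d) (n : nat) :
    ('I_n -> probability Y R) -> (n.-tuple Y -> \bar R) -> \bar R :=
  if n is n'.+1 then fun mu f =>
    (\int[mu ord0]_y
       product_integral (fun i : 'I_n' => mu (lift ord0 i))
         (fun o => f [tuple of y :: o]))%E
  else fun _ f => f [tuple].

(* The probability that, resumed from the partial transcript [h], the algorithm
   halts within [k] further rounds with a transcript in [E]. *)
Fixpoint run_prob (R : realType) (n : nat) d (Y : measurableType d)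
    (A : local_algorithm R n Y) (G : graph n) (E : set (transcript n Y))
    (k : nat) (h : transcript n Y) : \bar R :=
  if next_round A h is Some r then
    if k is k'.+1 then
      product_integral (fun i => output_law (Some r) i (adj_row G i))
        (fun o => run_prob A G E k' (rcons h o))
    else 0%E
  else (\1_E h)%:E.

Definition transcript_law (R : realType) (n : nat) d (Y : measurableType d)
    (A : local_algorithm R n Y) (G : graph n) (E : set (transcript n Y)) :
    \bar R :=
  limn (fun k => run_prob A G E k [::]).

(* The number of rounds may be unbounded, but a run is finite almost surely. *)
Definition halts (R : realType) (n : nat) d (Y : measurableType d)
    (A : local_algorithm R n Y) : Prop :=
  forall G : graph n, transcript_law A G setT = 1%E.

Definition LEDP (R : realType) (n : nat) d (Y : measurableType d)
    (eps delta : R) (A : local_algorithm R n Y) : Prop :=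
  forall G G' : graph n, edge_neighbors G G' ->
  forall E : set (transcript n Y), measurable E ->
    (transcript_law A G E <=
       (expR eps)%:E * transcript_law A G' E + delta%:E)%E.

(* [est] computes the answer from the final transcript. *)
Definition approximates_triangles (R : realType) (n : nat) d
    (Y : measurableType d) (F : set (graph n)) (alpha : R)
    (A : local_algorithm R n Y) (est : transcript n Y -> R) : Prop :=
  forall G : graph n, F G ->
    ((2 / 3)%:E <= transcript_law A G
       [set h | `|est h - (triangles G)%:R| <= alpha]%R)%E.

(* Main.v *)
Require Import Defs.
From HB Require Import structures.
From mathcomp Require Import all_boot all_order all_algebra.
From mathcomp Require Import all_classical all_reals all_analysis.
From mathcomp Require Import measurable_realfun.
From mathcomp Require Import lra zify.
Set Implicit Arguments.
Unset Strict Implicit.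
Unset Printing Implicit Defensive.
Import Order.TTheory GRing.Theory Num.Theory.
Import numFieldNormedType.Exports.
Local Open Scope classical_set_scope.
Local Open Scope ring_scope.

(* All graphs on n nodes are used.  For the hard instances, about half of the
   nodes are cut into N = Theta(n) groups of 2s nodes, every node outside the groups is
   joined to all grouped nodes, and group i is a clique iff a hidden bit x i is
   set; every set bit then accounts for Omega(s^2 n) triangles.  By independence
   of the nodes' coins, the law of the transcript has a density that is a product
   over the groups, so the relative entropy from the law for x = 0 to the law for
   independent Bernoulli(eta) bits is the sum of the relative entropies incurred
   by making a single bit random.  By privacy each of these is O(eta^2 eps^2).
   With eta ~ K / (eps sqrt n) the total is O(1), yet the count moves from 0 to
   order s^2 n N eta, which exceeds 2 alpha when alpha < c n^(3/2) / eps.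

   The constant s = 200 is large because for eps below K / sqrt n only
   alpha <= n^2 is available: eps is then raised to K / sqrt n, and alpha = n^2
   has to be beaten with eta <= 1/2.  When n is bounded, distinguishing three
   graphs with 0, 1 and 2 triangles gives alpha >= 1/2, and distinguishing the
   complete graph from the empty one gives eps >= 1 / (20 n^2). *)

(** * Densities of kernels *)

(** Comparing laws one group at a time, in a hybrid argument, costs order [eta * eps] per group,
    hence [sqrt n] in total. Relative entropy gains a factor because all densities have mass 1: the
    first-order term in [eta] integrates to 0 up to [delta], and only [eta^2] remains. The law for
    [x = 0] is the reference because the factor of group [i], taken relative to it, is the density
    ratio of the single-bit law, exactly what privacy controls.

    Two obstacles shape the proof. With [delta > 0] density ratios are unbounded and a logarithm
    need not be integrable. So ratios are capped at the privacy factor [B], and no logarithm or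
    entropy is formed: exponential inequalities give a pointwise bound between densities, which is
    integrated. Moreover, the rounds are adaptive and outputs lie in an arbitrary measurable space,
    so a product density requires one measure dominating the laws for all inputs, and factors
    jointly measurable in the history.

    Setting one bit changes at most [k = (2s)^2] edges, so privacy is used with [k * eps]. As [s] is
    constant this costs only the constant [L = k * e^k], the source of [K = 1/L]. *)

Section finite_measure_of_lty.
Context d (T : measurableType d) (R : realType).
Variables (mu : {measure set T -> \bar R}).
Hypothesis muoo : (mu setT < +oo)%E.

Let nu : set T -> \bar R := mu.
Let fin_nu : fin_num_fun nu. Proof. exact: lty_fin_num_fun. Qed.
HB.instance Definition _ := Measure.on nu.
HB.instance Definition _ := @Measure_isFinite.Build _ T R nu fin_nu.

Lemma finite_measure_of_lty :
  exists nu : {finite_measure set T -> \bar R}, forall A, nu A = mu A.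
Proof. by exists nu. Qed.

End finite_measure_of_lty.

Section semidirect.
Context d d' (S : measurableType d) (Y : measurableType d') (R : realType).
Variables (M : {finite_measure set S -> \bar R}) (k : S -> probability Y R).
Hypothesis mk : forall U, measurable U -> measurable_fun setT (fun s => k s U).

Let k' (s : S) : {measure set Y -> \bar R} := k s.

HB.instance Definition _ := isKernel.Build _ _ S Y R k' mk.
HB.instance Definition _ := Kernel_isProbability.Build _ _ S Y R k'
  (fun s => @probability_setT _ _ _ (k s)).

Lemma measurable_kernel_integral (F : S * Y -> \bar R) :
  measurable_fun setT F -> (forall z, (0 <= F z)%E) ->
  measurable_fun setT (fun s => \int[k s]_y F (s, y))%E.
Proof.
by move=> mF F0; exact: (@measurable_fun_integral_finite_kernel _ _ _ _ _ _ k').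
Qed.

(** [M] becomes a constant kernel out of [unit], and [k2] below draws [y] from [k s] while keeping
    [s]. Their composition is the joint law [M(ds) k(s, dy)]. *)
Let l (_ : unit) : {measure set S -> \bar R} := M.
Let ml U : measurable U -> measurable_fun setT (fun x => l x U).
Proof. by move=> _; exact: measurable_cst. Qed.
HB.instance Definition _ := isKernel.Build _ _ unit S R l ml.
Let luub : measure_fam_uub l.
Proof.
exists (fine (M setT) + 1) => _ /=; rewrite EFinD fineK ?fin_num_measure//.
by rewrite lteDl// fin_num_measure.
Qed.
HB.instance Definition _ := Kernel_isFinite.Build _ _ unit S R l luub.

Let mpair (s : S) : measurable_fun setT (fun y : Y => (s, y)).
Proof. exact: pair1_measurable. Qed.

Let k2 (x : unit * S) : {measure set (S * Y) -> \bar R} :=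
  measure_function_pushforward__canonical__measure_function_Measure
    (k x.2) (mpair x.2).

Let k2E x B : k2 x B = k x.2 (xsection B x.2).
Proof. by rewrite xsectionE. Qed.

Let mk2 U : measurable U -> measurable_fun setT (fun x => k2 x U).
Proof.
move=> mU; under eq_fun do rewrite k2E.
apply: (@measurableT_comp _ _ _ _ _ _ (fun s => k s (xsection U s)) _ snd) => //.
by apply: (@measurable_fun_xsection_finite_kernel _ _ _ _ _ k'); rewrite inE.
Qed.
HB.instance Definition _ := isKernel.Build _ _ (unit * S)%type (S * Y)%type R k2 mk2.
Let k2T x : k2 x setT = 1%E.
Proof. by rewrite k2E xsectionE preimage_setT probability_setT. Qed.
HB.instance Definition _ :=
  Kernel_isProbability.Build _ _ (unit * S)%type (S * Y)%type R k2 k2T.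

Lemma semidirect_measure :
  exists J : {finite_measure set (S * Y)%type -> \bar R},
  forall F : S * Y -> \bar R,
    measurable_fun setT F -> (forall z, (0 <= F z)%E) ->
    (\int[J]_z F z = \int[M]_s \int[k s]_y F (s, y))%E.
Proof.
pose J0 : {measure set (S * Y) -> \bar R} := mkcomp l k2 tt.
have J0E (F : S * Y -> \bar R) : measurable_fun setT F -> (forall z, (0 <= F z)%E) ->
    (\int[J0]_z F z = \int[M]_s \int[k s]_y F (s, y))%E.
  move=> mF F0; rewrite /J0 /mkcomp integral_kcomp//.
  apply: eq_integral => s _ /=.
  by rewrite ge0_integral_pushforward// => y _; exact: F0.
have [|J JE] := @finite_measure_of_lty _ _ _ J0.
  rewrite -[X in (X < _)%E]mul1e -integral_cst// J0E//.
  have k1 (s : S) : (\int[k s]_y cst 1 (s, y) = 1)%E.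
    by rewrite integral_cst// mul1e; exact: probability_setT.
  under eq_integral do rewrite k1.
  rewrite integral_cst// mul1e -ge0_fin_numE//.
  exact: (fin_num_measure M setT measurableT).
exists J => F mF F0; rewrite -J0E//.
by apply: eq_measure_integral => A _ _; exact: JE.
Qed.

End semidirect.

Section kernel_density.
Context d d' (S : measurableType d) (Y : measurableType d') (R : realType)
  (I : finType).
Variables (M : {finite_measure set S -> \bar R}) (k : I -> S -> probability Y R).
Hypothesis mk : forall i U, measurable U ->
  measurable_fun setT (fun s => k i s U).

(* Radon-Nikodym is applied on the product space: the densities of the
   individual measures [k i s] need not be jointly measurable in [s]. *)
Lemma kernel_density :
  exists (J : {finite_measure set (S * Y)%type -> \bar R}) (f : I -> S * Y -> R),
  [/\ forall i, measurable_fun setT (f i), forall i z, 0 <= f i z &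
   forall i (F : S * Y -> \bar R),
     measurable_fun setT F -> (forall z, (0 <= F z)%E) ->
     (\int[M]_s \int[k i s]_y F (s, y) = \int[J]_z (F z * (f i z)%:E))%E].
Proof.
have /choice[Ji JiE] i := semidirect_measure M (mk i).
(* As [I] is finite, the sum of the joint measures is finite and dominates each of them. Indices
   from [#|I|] on are padded with the zero measure. *)
pose m_ (j : nat) : {measure set (S * Y) -> \bar R} :=
  if insub j is Some j' then Ji (enum_val (j' : 'I_#|I|)) else mzero.
have [|J JE] := @finite_measure_of_lty _ _ _ (msum m_ #|I|).
  rewrite /msum/=; apply: lte_sum_pinfty => /= j _.
  rewrite /m_; case: insub => [j'|]; last exact: ltry.
  by rewrite -ge0_fin_numE//; exact: (fin_num_measure (Ji _) setT measurableT).
have Jdom i : Ji i `<< J.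
  apply/null_content_dominatesP => A mA JA0.
  have JA : msum m_ #|I| A = 0%E by rewrite -JE.
  apply/eqP; rewrite -measure_le0 -JA /msum (bigD1 (enum_rank i))//=.
  rewrite {1}/m_ valK enum_rankK leeDl// sume_ge0//.
pose g i := Radon_Nikodym_SigmaFinite.f (Ji i) J.
have gfin i z : g i z \is a fin_num.
  exact: Radon_Nikodym_SigmaFinite.f_fin_num.
have g0 i z : (0 <= g i z)%E by exact: Radon_Nikodym_SigmaFinite.f_ge0.
exists J, (fun i z => fine (g i z)); split.
- move=> i; apply: measurableT_comp => //.
  exact: (measurable_int _ (Radon_Nikodym_SigmaFinite.f_integrable (Jdom i))).
- by move=> i z; rewrite fine_ge0.
- move=> i F mF F0; rewrite -JiE//.
  rewrite -(Radon_Nikodym_SigmaFinite.change_of_variables (Jdom i))//.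
  by apply: eq_integral => z _; rewrite fineK.
Qed.

End kernel_density.

Lemma finite_pushforward d d' (S : measurableType d) (T : measurableType d')
    (R : realType) (M : {finite_measure set S -> \bar R}) (phi : S -> T) :
  measurable_fun setT phi ->
  exists J : {finite_measure set T -> \bar R}, forall F : T -> \bar R,
    measurable_fun setT F -> (forall t, (0 <= F t)%E) ->
    (\int[J]_t F t = \int[M]_s F (phi s))%E.
Proof.
move=> mphi.
pose J0 : {measure set T -> \bar R} :=
  measure_function_pushforward__canonical__measure_function_Measure M mphi.
have [|J JE] := @finite_measure_of_lty _ _ _ J0.
  rewrite /J0/= /pushforward preimage_setT -ge0_fin_numE//.
  exact: (fin_num_measure M setT measurableT).
exists J => F mF F0.
rewrite (eq_measure_integral J0) => [|A _ _]; last exact: JE.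
by rewrite ge0_integral_pushforward// => y _; exact: F0.
Qed.

(** * Independent outputs of all parties in one round *)

Section product_integral.
Context d (Y : measurableType d) (R : realType).

Lemma product_integral_ge0 n (mu : 'I_n -> probability Y R)
    (F : n.-tuple Y -> \bar R) :
  (forall o, (0 <= F o)%E) -> (0 <= product_integral mu F)%E.
Proof.
elim: n => [|n IH] in mu F *; first exact.
by move=> F0 /=; apply: integral_ge0 => y _; exact: IH.
Qed.

Lemma measurable_product_integral n d' (S : measurableType d')
    (k : 'I_n -> S -> probability Y R) (F : S * n.-tuple Y -> \bar R) :
  (forall i U, measurable U -> measurable_fun setT (fun s => k i s U)) ->
  measurable_fun setT F -> (forall z, (0 <= F z)%E) ->
  measurable_fun setT
    (fun s => product_integral (fun i => k i s) (fun o => F (s, o))).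
Proof.
elim: n => [|n IH] in d' S k F *; move=> mk mF F0 /=.
  apply: (measurableT_comp mF); exact: measurable_fun_pair.
pose F' (z : S * Y) := product_integral
  (fun i : 'I_n => k (lift ord0 i) z.1) (fun o => F (z.1, [tuple of z.2 :: o])).
apply: (@measurable_kernel_integral _ _ _ _ _ (k ord0) (mk ord0) F').
  apply: (IH _ (S * Y)%type (fun i z => k (lift ord0 i) z.1)
    (fun z => F (z.1.1, [tuple of z.1.2 :: z.2]))) => //.
    move=> i U mU; apply: (@measurableT_comp _ _ _ _ _ _
      (fun s => k (lift ord0 i) s U) _ fst) => //; exact: mk.
  apply: (measurableT_comp mF); apply: measurable_fun_pair.
    exact: measurableT_comp.
  by apply: measurable_cons => //; exact: measurableT_comp.
by move=> z; apply: product_integral_ge0 => o; exact: F0.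
Qed.

Lemma measurable_product_integral_behead n (mu : 'I_n -> probability Y R)
    (F : n.+1.-tuple Y -> \bar R) :
  measurable_fun setT F -> (forall o, (0 <= F o)%E) ->
  measurable_fun setT
    (fun y => product_integral mu (fun o => F [tuple of y :: o])).
Proof.
move=> mF F0.
apply: (@measurable_product_integral n _ Y (fun i _ => mu i)
  (fun z => F [tuple of z.1 :: z.2])) => //.
by apply: (measurableT_comp mF); exact: measurable_cons.
Qed.

Lemma product_integralZr n (mu : 'I_n -> probability Y R)
    (F : n.-tuple Y -> \bar R) (c : R) :
  measurable_fun setT F -> (forall o, (0 <= F o)%E) -> 0 <= c ->
  product_integral mu (fun o => F o * c%:E)%E
  = (product_integral mu F * c%:E)%E.
Proof.
elim: n => [|n IH] in mu F *; move=> mF F0 c0 //=.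
rewrite -ge0_integralZr//.
- apply: eq_integral => y _; rewrite IH//.
  by apply: (measurableT_comp mF); exact: measurable_cons.
- exact: measurable_product_integral_behead.
- by move=> y _; exact: product_integral_ge0.
Qed.

End product_integral.

(** Induction on the parties: the output of party 0 is absorbed into the parameter space, with its
    factor supplied by [kernel_density], and the kernels of the other parties ignore it.
    Independence lets factor [i] see the input [a i] alone, while one [J] serves all input
    assignments. *)
Lemma product_integral_density d (Y : measurableType d) (R : realType)
    (I : finType) n d' (S : measurableType d')
    (M : {finite_measure set S -> \bar R})
    (k : 'I_n -> I -> S -> probability Y R) :
  (forall i a U, measurable U -> measurable_fun setT (fun s => k i a s U)) ->
  exists (J : {finite_measure set (S * n.-tuple Y)%type -> \bar R})
    (f : 'I_n -> I -> S * n.-tuple Y -> R),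
  [/\ forall i a, measurable_fun setT (f i a), forall i a z, 0 <= f i a z &
   forall (a : 'I_n -> I) (F : S * n.-tuple Y -> \bar R),
     measurable_fun setT F -> (forall z, (0 <= F z)%E) ->
     (\int[M]_s product_integral (fun i => k i (a i) s) (fun o => F (s, o))
      = \int[J]_z (F z * (\prod_i f i (a i) z)%:E))%E].
Proof.
elim: n => [|n IH] in d' S M k *; move=> mk.
  have mpair : measurable_fun setT (fun s : S => (s, [tuple] : 0.-tuple Y)).
    exact: measurable_fun_pair.
  have [J JE] := finite_pushforward M mpair.
  exists J, (fun _ _ _ => 1); split => // a F mF F0.
  rewrite JE//; first by apply: eq_integral => s _; rewrite big_ord0 mule1.
    by under eq_fun do rewrite big_ord0 mule1.
  by move=> z; rewrite big_ord0 mule1.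
have [J0 [f0 [mf0 f0_ge0 J0E]]] := kernel_density M (mk ord0).
pose k' (i : 'I_n) a (z : S * Y) := k (lift ord0 i) a z.1.
have mk' i a U : measurable U -> measurable_fun setT (fun z => k' i a z U).
  move=> mU; apply: (@measurableT_comp _ _ _ _ _ _
    (fun s => k (lift ord0 i) a s U) _ fst) => //; exact: mk.
have [J1 [f1 [mf1 f1_ge0 J1E]]] := IH _ _ J0 k' mk'.
(* [phi] moves the absorbed output from the parameter back into the tuple and [psi] undoes this, so
   the densities found by induction can be read on [S * n.+1.-tuple Y]. *)
pose phi (z : S * Y * n.-tuple Y) := (z.1.1, [tuple of z.1.2 :: z.2]).
have mphi : measurable_fun setT phi.
  apply: measurable_fun_pair; first exact: measurableT_comp.
  by apply: measurable_cons => //; exact: measurableT_comp.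
pose psi0 (z : S * n.+1.-tuple Y) := (z.1, tnth z.2 ord0).
have mpsi0 : measurable_fun setT psi0.
  apply: measurable_fun_pair => //.
  by apply: (@measurableT_comp _ _ _ _ _ _ (@tnth _ _ ^~ ord0)) => //;
    exact: measurable_tnth.
pose psi (z : S * n.+1.-tuple Y) := (psi0 z, [tuple of behead z.2]).
have mpsi : measurable_fun setT psi.
  apply: measurable_fun_pair => //.
  by apply: (measurableT_comp (@measurable_behead _ _ _)).
have phiK z : psi (phi z) = z.
  case: z => -[s y] o; rewrite /psi /psi0 /phi/=.
  by congr (_, _, _); exact: val_inj.
have [J JE] := finite_pushforward J1 mphi.
pose f (i : 'I_n.+1) a z :=
  if unlift ord0 i is Some j then f1 j a (psi z) else f0 a (psi0 z).
have mf i a : measurable_fun setT (f i a).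
  by rewrite /f; case: unlift => [j|]; exact: measurableT_comp.
have f_ge0 i a z : 0 <= f i a z by rewrite /f; case: unlift => [j|].
have prodE (a : 'I_n.+1 -> I) z : \prod_i f i (a i) (phi z) =
    f0 (a ord0) z.1 * \prod_i f1 i (a (lift ord0 i)) z.
  rewrite big_ord_recl {1}/f unlift_none; congr (f0 _ _ * _).
    by case: z => -[].
  by apply: eq_bigr => i _; rewrite /f liftK phiK.
exists J, f; split => // a F mF F0.
rewrite JE; last 2 first.
- apply: emeasurable_funM => //; apply/measurable_EFinP.
  exact: measurable_prod.
- by move=> z; rewrite mule_ge0// lee_fin prodr_ge0.
pose F1 (z : S * Y * n.-tuple Y) := (F (phi z) * (f0 (a ord0) z.1)%:E)%E.
have mFphi : measurable_fun setT (F \o phi) by exact: measurableT_comp.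
have mF1 : measurable_fun setT F1.
  apply: emeasurable_funM => //; apply/measurable_EFinP.
  exact: measurableT_comp.
have F1_ge0 z : (0 <= F1 z)%E by rewrite mule_ge0// lee_fin.
transitivity (\int[J1]_z (F1 z *
    (\prod_i f1 i (a (lift ord0 i)) z)%:E))%E; last first.
  by apply: eq_integral => z _; rewrite prodE /F1 EFinM muleA.
rewrite -(J1E (fun i => a (lift ord0 i)))//.
rewrite /=.
rewrite (J0E (a ord0) (fun z => product_integral
  (fun i : 'I_n => k (lift ord0 i) (a (lift ord0 i)) z.1)
  (fun o => F (phi (z, o)))))//.
- apply: eq_integral => z _; rewrite -product_integralZr//.
  by apply: (measurableT_comp mFphi); exact: measurable_fun_pair.
- apply: (@measurable_product_integral _ _ _ n _ _
    (fun i => k' i (a (lift ord0 i))) (F \o phi)) => [i U||z];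
    [exact: mk'|exact: mFphi|exact: F0].
- by move=> z; apply: product_integral_ge0 => o; exact: F0.
Qed.

(** * Transcripts as a measurable space *)

Lemma measurable_fun_countable_cases d d' (S : measurableType d)
    (Z : measurableType d') (s : S -> nat) (f : S -> Z) (g : nat -> S -> Z) :
  (forall k, measurable [set x | s x = k]) ->
  (forall k, measurable_fun setT (g k)) ->
  (forall k x, s x = k -> f x = g k x) ->
  measurable_fun setT f.
Proof.
move=> ms mg fg _ U mU; rewrite setTI.
have -> : f @^-1` U = \bigcup_k ([set x | s x = k] `&` g k @^-1` U).
  apply/seteqP; split => x /=.
    by move=> Ux; exists (s x) => //; split => //=; rewrite -(fg _ _ erefl).
  by case=> k _ [sk /=]; rewrite (fg k).
apply: bigcup_measurable => k _; apply: measurableI => //.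
by rewrite -[X in measurable X]setTI; exact: mg.
Qed.

Section transcripts.
Context (n : nat) d (Y : measurableType d).
Local Notation T := (transcript n Y).
Local Notation O := (n.-tuple Y).

Lemma measurable_transcriptE (E : set T) : measurable E =
  forall k, measurable [set t : k.-tuple O | E (tval t)].
Proof. by []. Qed.

Lemma measurable_size_transcript k : measurable [set t : T | size t = k].
Proof.
rewrite measurable_transcriptE => j /=; case: (eqVneq j k) => [jk|jk].
  rewrite (_ : [set t | _] = setT)//.
  by apply/seteqP; split => // t _ /=; rewrite size_tuple.
rewrite (_ : [set t | _] = set0)//.
by apply/seteqP; split => // t /=; rewrite size_tuple => /eqP; rewrite (negbTE jk).
Qed.

Lemma measurable_nth_transcript i :
  measurable_fun setT (fun t : T => nth (point : O) t i).
Proof.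
move=> _ U mU; rewrite setTI measurable_transcriptE => k /=.
have [ik|ki] := ltnP i k.
  have := @measurable_tnth _ O k (Ordinal ik) measurableT U mU.
  rewrite setTI; congr measurable; apply/seteqP; split => t /=;
    by rewrite (tnth_nth point).
rewrite (_ : [set t | _] = if `[< U point >] then setT else set0).
  by case: ifP => _; [exact: measurableT|exact: measurable0].
by case: asboolP => Up; apply/seteqP; split => t //=;
  rewrite nth_default ?size_tuple.
Qed.

Lemma measurable_mktuple d' (S : measurableType d') k (f : nat -> S -> O) :
  (forall i, measurable_fun setT (f i)) ->
  measurable_fun setT (fun x => [tuple f i x | i < k] : T).
Proof.
move=> mf; have mt : measurable_fun setT (fun x => [tuple f i x | i < k]).
  apply/measurable_fun_tnthP => i.
  by rewrite (_ : _ \o _ = f i)//; apply/funext => x /=; rewrite tnth_mktuple.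
move=> _ E mE; rewrite setTI.
have mEk : measurable [set t : k.-tuple O | E (tval t)] := mE k.
by have := mt measurableT _ mEk; rewrite setTI.
Qed.

Lemma measurable_rcons_transcript :
  measurable_fun setT (fun z : T * O => rcons z.1 z.2 : T).
Proof.
pose f k i (z : T * O) := if (i < k)%N then nth point z.1 i else z.2.
have msize k : measurable [set z : T * O | size z.1 = k].
  have := @measurable_fst _ _ T O measurableT _ (measurable_size_transcript k).
  by rewrite setTI.
apply: (@measurable_fun_countable_cases _ _ (T * O)%type T (fun z => size z.1) _
  (fun k z => [tuple f k i z | i < k.+1] : T)) => //.
  move=> k; apply: measurable_mktuple => i; rewrite /f; case: ltnP => _.
    apply: (@measurableT_comp _ _ _ _ _ _ (fun t : T => nth point t i) _ fst) => //.
    exact: measurable_nth_transcript.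
  exact: measurable_snd.
move=> k [h o] /= hk; apply: (@eq_from_nth _ point).
  by rewrite size_rcons size_map size_enum_ord hk.
move=> i; rewrite size_rcons hk => ik.
rewrite (nth_map (Ordinal ik)) ?size_enum_ord// nth_enum_ord//.
rewrite nth_rcons hk /f; case: ltnP => // ki.
by rewrite (_ : i == k) //= eqn_leq ki andbT -ltnS.
Qed.

(** With [last_output] this inverts [rcons]: the density of one round, a function of the history and
    the new outputs, becomes a measurable function of the extended transcript. *)
Definition trunc_transcript (t : T) : T := take (size t).-1 t.

Lemma measurable_trunc_transcript : measurable_fun setT trunc_transcript.
Proof.
apply: (@measurable_fun_countable_cases _ _ T _ size _
  (fun k t => [tuple nth point t i | i < k.-1] : T)) => //.
- exact: measurable_size_transcript.
- move=> k; apply: (@measurable_mktuple _ T k.-1 (fun i t => nth point t i)) => i.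
  exact: measurable_nth_transcript.
move=> k t tk; apply: (@eq_from_nth _ point).
  by rewrite size_takel ?leq_pred// tk size_map size_enum_ord.
rewrite size_takel ?leq_pred// tk => i ik.
by rewrite (nth_map (Ordinal ik)) ?size_enum_ord// nth_enum_ord// nth_take ?tk.
Qed.

Definition last_output (t : T) : O := last point t.

Lemma measurable_last_output : measurable_fun setT last_output.
Proof.
apply: (@measurable_fun_countable_cases _ _ T _ size _
  (fun k (t : T) => nth point t k.-1)) => //.
- exact: measurable_size_transcript.
- by move=> k; exact: measurable_nth_transcript.
by move=> k t <-; rewrite /last_output -nth_last.
Qed.

Lemma trunc_rcons (h : T) (o : O) : trunc_transcript (rcons h o) = h.
Proof. by rewrite /trunc_transcript size_rcons /= -cats1 take_size_cat. Qed.

Lemma last_rcons_output (h : T) (o : O) : last_output (rcons h o) = o.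
Proof. exact: last_rcons. Qed.

End transcripts.

Lemma ge0_integral_mrestr d (T : measurableType d) (R : realType)
    (mu : {measure set T -> \bar R}) D (mD : measurable D) (F : T -> \bar R) :
  measurable_fun setT F -> (forall t, (0 <= F t)%E) ->
  (\int[mrestr mu mD]_t F t = \int[mu]_(t in D) F t)%E.
Proof.
move=> mF F0; rewrite -(setUv D).
rewrite (ge0_integral_setU _ mD (measurableC mD))//; last 2 first.
- by rewrite setUv.
- by apply/disj_setPS; rewrite setICr.
rewrite [X in (_ + X)%E](@eq_measure_integral _ _ _ _ mzero); last first.
  move=> A mA; rewrite subsets_disjoint setCK => AD.
  by rewrite /= /mrestr AD measure0.
rewrite integral_measure_zero adde0; apply: eq_measure_integral => A mA AD.
by rewrite /= /mrestr setIidl.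
Qed.

(** * The density of the transcript *)

Section transcript_density.
Context (R : realType) (n : nat) d (Y : measurableType d).
Variable A : local_algorithm R n Y.
Local Notation T := (transcript n Y).
Local Notation O := (n.-tuple Y).
Local Notation row := {ffun 'I_n -> bool}.

Local Notation halted := [set h | next_round A h = None].

(** Also defined at halted histories, where [output_law] is a point mass. [rounds_integral] removes
    those by an indicator. *)
Definition round_integral (a : 'I_n -> row) (F : T -> \bar R) (h : T) : \bar R :=
  product_integral (fun i => output_law (next_round A h) i (a i))
    (fun o => F (rcons h o)).

(* The expectation of [F] over the transcripts of [j] rounds, on the event that
   the algorithm has not halted before round [j]. *)
Fixpoint rounds_integral (a : 'I_n -> row) (j : nat) (F : T -> \bar R) : \bar R :=
  if j is j'.+1 then
    rounds_integral a j' (fun h => (round_integral a F h * (\1_(~` halted) h)%:E)%E)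
  else F [::].

Lemma measurable_round_integral a F :
  measurable_fun setT F -> (forall t, (0 <= F t)%E) ->
  measurable_fun setT (round_integral a F).
Proof.
move=> mF F0.
apply: (@measurable_product_integral _ _ _ _ _ T
  (fun i h => output_law (next_round A h) i (a i))
  (fun z => F (rcons z.1 z.2))) => //.
- by move=> i U mU; exact: measurable_output_law.
- exact: (measurableT_comp mF (@measurable_rcons_transcript _ _ _)).
Qed.

Lemma round_integral_ge0 a F h : (forall t, (0 <= F t)%E) ->
  (0 <= round_integral a F h)%E.
Proof. by move=> F0; exact: product_integral_ge0. Qed.

Lemma measurable_indic_halted : measurable_fun setT (\1_halted : T -> R).
Proof. by apply: measurable_indic; exact: measurable_halt. Qed.

Lemma measurable_indic_alive : measurable_fun setT (\1_(~` halted) : T -> R).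
Proof. by apply: measurable_indic; apply: measurableC; exact: measurable_halt. Qed.

(** Given the history, one more round multiplies the density by a product over the nodes, so
    products over rounds of products over nodes regroup as one factor per node. [c] collects the
    indicators that the algorithm was still running, which depend on the transcript and on no
    row. *)
Lemma rounds_integral_density (j : nat) :
  exists (M : {finite_measure set T -> \bar R}) (c : T -> R)
    (g : 'I_n -> row -> T -> R),
  [/\ measurable_fun setT c, forall t, 0 <= c t,
      forall i b, measurable_fun setT (g i b), forall i b t, 0 <= g i b t &
      forall a F, measurable_fun setT F -> (forall t, (0 <= F t)%E) ->
      rounds_integral a j F =
      (\int[M]_t (F t * (c t * \prod_i g i (a i) t)%:E))%E].
Proof.
elim: j => [|j [M [c [g [mc c0 mg g0 ME]]]]].
  exists (\d_([::] : T)), (fun _ => 1), (fun _ _ _ => 1); split => // a F mF F0.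
  under eq_integral do rewrite big1// mulr1 mule1.
  by rewrite integral_dirac// diracT mul1e.
pose k (i : 'I_n) b h := output_law (next_round A h) i b.
have mk i b U : measurable U -> measurable_fun setT (fun h => k i b h U).
  exact: measurable_output_law.
have [J [f [mf f0 JE]]] := product_integral_density M mk.
have [M' M'E] := finite_pushforward J (@measurable_rcons_transcript n _ Y).
pose split_last (t : T) := (trunc_transcript t, last_output t).
have msplit : measurable_fun setT split_last.
  apply: measurable_fun_pair; first exact: measurable_trunc_transcript.
  exact: measurable_last_output.
pose c1 h := \1_(~` halted) h * c h.
have mc1 : measurable_fun setT c1.
  by apply: measurable_funM => //; exact: measurable_indic_alive.
have c1_ge0 h : 0 <= c1 h by rewrite mulr_ge0.
pose c' t := c1 (trunc_transcript t).
pose g' i b t := g i b (trunc_transcript t) * f i b (split_last t).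
have mc' : measurable_fun setT c'.
  exact: (measurableT_comp mc1 (@measurable_trunc_transcript _ _ _)).
have mg' i b : measurable_fun setT (g' i b).
  apply: measurable_funM.
    exact: (measurableT_comp (mg i b) (@measurable_trunc_transcript _ _ _)).
  exact: (measurableT_comp (mf i b) msplit).
have g'0 i b t : 0 <= g' i b t by rewrite mulr_ge0.
exists M', c', g'; split => //; first by move=> t; exact: c1_ge0.
move=> a F mF F0.
pose w h := c1 h * \prod_i g i (a i) h.
have mw : measurable_fun setT w.
  by apply: measurable_funM => //; exact: measurable_prod.
have w0 h : 0 <= w h by rewrite mulr_ge0 ?prodr_ge0.
have mFr : measurable_fun setT (fun z : T * O => F (rcons z.1 z.2)).
  exact: (measurableT_comp mF (@measurable_rcons_transcript _ _ _)).
rewrite M'E; last 2 first.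
- apply: emeasurable_funM => //; apply/measurable_EFinP/measurable_funM => //.
  exact: measurable_prod.
- by move=> t; rewrite mule_ge0// lee_fin mulr_ge0 ?prodr_ge0// c1_ge0.
rewrite /= ME; last 2 first.
- apply: emeasurable_funM; first exact: measurable_round_integral.
  by apply/measurable_EFinP; exact: measurable_indic_alive.
- by move=> t; rewrite mule_ge0 ?lee_fin//; exact: round_integral_ge0.
transitivity (\int[M]_h product_integral (fun i => k i (a i) h)
    (fun o => F (rcons h o) * (w h)%:E))%E.
  apply: eq_integral => h _; rewrite product_integralZr//.
    by rewrite -muleA -EFinM mulrA.
    exact: (measurableT_comp mFr (pair1_measurable h)).
rewrite (JE a (fun z => F (rcons z.1 z.2) * (w z.1)%:E)%E).
- apply: eq_integral => -[h o] _ /=.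
  rewrite /c' /g' /split_last trunc_rcons last_rcons_output -muleA -EFinM.
  by rewrite big_split/= /w !mulrA.
- apply: emeasurable_funM => //; apply/measurable_EFinP.
  exact: (measurableT_comp mw).
- by move=> z; rewrite mule_ge0// lee_fin.
Qed.

Lemma rounds_integral_ge0 a j F : (forall t, (0 <= F t)%E) ->
  (0 <= rounds_integral a j F)%E.
Proof.
elim: j F => [|j IH] F F0 //=; apply: IH => t.
by rewrite mule_ge0 ?lee_fin//; exact: round_integral_ge0.
Qed.

Lemma eq_rounds_integral a j F F' : (forall t, size t = j -> F t = F' t) ->
  rounds_integral a j F = rounds_integral a j F'.
Proof.
elim: j F F' => [|j IH] F F' FF' /=; first exact: FF'.
apply: IH => t tj; congr (_ * _)%E; congr (product_integral _ _).
by apply/funext => o; rewrite FF'// size_rcons tj.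
Qed.

Lemma rounds_integralD a j F1 F2 :
  measurable_fun setT F1 -> (forall t, (0 <= F1 t)%E) ->
  measurable_fun setT F2 -> (forall t, (0 <= F2 t)%E) ->
  rounds_integral a j (fun t => F1 t + F2 t)%E =
  (rounds_integral a j F1 + rounds_integral a j F2)%E.
Proof.
move=> mF1 F1_ge0 mF2 F2_ge0.
have [M [c [g [mc c0 mg g0 ME]]]] := rounds_integral_density j.
have w0 t : 0 <= c t * \prod_i g i (a i) t by rewrite mulr_ge0 ?prodr_ge0.
have mw : measurable_fun setT (fun t => (c t * \prod_i g i (a i) t)%:E).
  by apply/measurable_EFinP/measurable_funM => //; exact: measurable_prod.
rewrite !ME//; last 2 first.
- exact: emeasurable_funD.
- by move=> t; rewrite adde_ge0.
rewrite -ge0_integralD//.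
- by apply: eq_integral => t _; rewrite ge0_muleDl.
- by move=> t _; rewrite mule_ge0 ?lee_fin.
- exact: emeasurable_funM.
- by move=> t _; rewrite mule_ge0 ?lee_fin.
- exact: emeasurable_funM.
Qed.

(** * Decomposition by the halting time *)

Section run.
Variables (G : graph n) (E : set T).
Hypothesis mE : measurable E.
Let a := adj_row G.
Let E_halted (h : T) := (\1_(E `&` halted) h : R)%:E.

Lemma run_probS k h : run_prob A G E k.+1 h =
  (E_halted h + round_integral a (run_prob A G E k) h * (\1_(~` halted) h)%:E)%E.
Proof.
rewrite /= /E_halted /round_integral !indicE in_setI in_setC.
have [N|N] := pselect (next_round A h = None).
  have -> : h \in halted by exact/mem_set.
  by rewrite N andbT mule0 adde0.
have -> : (h \in halted) = false by exact/memNset.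
rewrite andbF add0e mule1.
by case: (next_round A h) N.
Qed.

Lemma run_prob0 h : run_prob A G E 0 h = E_halted h.
Proof.
rewrite /= /E_halted !indicE in_setI.
have [N|N] := pselect (next_round A h = None).
  have -> : h \in halted by exact/mem_set.
  by rewrite N andbT.
have -> : (h \in halted) = false by exact/memNset.
by rewrite andbF; case: (next_round A h) N.
Qed.

Lemma E_halted_ge0 h : (0 <= E_halted h)%E. Proof. by rewrite lee_fin. Qed.

Lemma measurable_E_halted : measurable_fun setT E_halted.
Proof.
apply/measurable_EFinP; apply: measurable_indic; apply: measurableI => //.
exact: measurable_halt.
Qed.

Lemma run_prob_ge0 k h : (0 <= run_prob A G E k h)%E.
Proof.
elim: k h => [|k IH] h; first by rewrite run_prob0 E_halted_ge0.
rewrite run_probS adde_ge0 ?E_halted_ge0// mule_ge0 ?lee_fin//.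
exact: round_integral_ge0.
Qed.

Lemma measurable_run_prob k : measurable_fun setT (run_prob A G E k).
Proof.
elim: k => [|k IH].
  by rewrite (funext run_prob0); exact: measurable_E_halted.
rewrite (funext (run_probS k)); apply: emeasurable_funD.
  exact: measurable_E_halted.
apply: emeasurable_funM.
  by apply: measurable_round_integral => //; exact: run_prob_ge0.
by apply/measurable_EFinP; exact: measurable_indic_alive.
Qed.

(** The [j]-th term is the probability of halting after exactly [j] rounds with a transcript in [E].
    The proof unrolls [m] rounds and leaves the rest to [run_prob]. *)
Lemma run_prob_sum k : run_prob A G E k [::] =
  (\sum_(0 <= j < k.+1) rounds_integral a j E_halted)%E.
Proof.
suff H m : (m <= k)%N -> run_prob A G E k [::] =
    (\sum_(0 <= j < m) rounds_integral a j E_halted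
     + rounds_integral a m (run_prob A G E (k - m)))%E.
  by rewrite (H k)// subnn (funext run_prob0) big_nat_recr.
elim: m => [|m IH] mk; first by rewrite big_geq// add0e subn0.
rewrite (IH (ltnW mk)) big_nat_recr//= -addeA; congr (_ + _)%E.
rewrite -[(k - m)%N](@prednK) ?subn_gt0// -subnS.
rewrite (funext (run_probS _)) rounds_integralD//.
- exact: measurable_E_halted.
- exact: E_halted_ge0.
- apply: emeasurable_funM; last by apply/measurable_EFinP; exact: measurable_indic_alive.
  by apply: measurable_round_integral; [exact: measurable_run_prob|exact: run_prob_ge0].
- move=> t; rewrite mule_ge0 ?lee_fin//.
  by apply: round_integral_ge0; exact: run_prob_ge0.
Qed.

Lemma transcript_law_series : transcript_law A G E =
  (\sum_(0 <= j <oo) rounds_integral a j E_halted)%E.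
Proof.
rewrite /transcript_law (funext run_prob_sum).
have cv := @is_cvg_ereal_nneg_natsum R
  (fun j => rounds_integral a j E_halted) 0%N
  (fun j _ => rounds_integral_ge0 a j E_halted_ge0).
by apply/cvg_lim => //; move: cv; rewrite -cvg_shiftS.
Qed.

End run.

(* Every node replies from its own row with independent coins, so the density of
   the transcript is a product of functions of one row each. *)
Theorem transcript_law_density :
  exists (M : {measure set T -> \bar R}) (c : T -> R) (g : 'I_n -> row -> T -> R),
  [/\ measurable_fun setT c, forall t, 0 <= c t,
      forall i b, measurable_fun setT (g i b), forall i b t, 0 <= g i b t &
      forall G E, measurable E ->
      transcript_law A G E =
      (\int[M]_(t in E) (c t * \prod_i g i (adj_row G i) t)%:E)%E].
Proof.
have /choice[M_ /choice[c_ /choice[g_ H]]] := rounds_integral_density.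
(* Restricting [M_ j] to transcripts of [j] rounds keeps the summands on disjoint sets, so the
   densities for the different [j] are glued into one by reading off [size t]. *)
pose M : {measure set T -> \bar R} :=
  mseries (fun j => mrestr (M_ j) (@measurable_size_transcript n _ Y j)) 0.
pose c (t : T) := \1_halted t * c_ (size t) t.
pose g i b (t : T) := g_ (size t) i b t.
have mc : measurable_fun setT c.
  apply: measurable_funM; first exact: measurable_indic_halted.
  apply: (@measurable_fun_countable_cases _ _ T R size _ c_) => //.
  - exact: measurable_size_transcript.
  - by move=> k; have [] := H k.
  - by move=> k t <-.
have mg i b : measurable_fun setT (g i b).
  apply: (@measurable_fun_countable_cases _ _ T R size _ (fun k => g_ k i b)) => //.
  - exact: measurable_size_transcript.
  - by move=> k; have [] := H k.
  - by move=> k t <-.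
have c0 t : 0 <= c t by rewrite mulr_ge0//; have [] := H (size t).
have g0 i b t : 0 <= g i b t by rewrite /g; have [] := H (size t).
exists M, c, g; split => // G E mE.
set a := adj_row G.
pose F t := ((\1_E t)%:E * (c t * \prod_i g i (a i) t)%:E)%E.
have mF : measurable_fun setT F.
  apply: emeasurable_funM; first exact/measurable_EFinP/measurable_indic.
  by apply/measurable_EFinP/measurable_funM => //; exact: measurable_prod.
have F0 t : (0 <= F t)%E by rewrite mule_ge0 ?lee_fin// mulr_ge0 ?prodr_ge0.
rewrite transcript_law_series// integral_mkcond.
transitivity (\int[M]_t F t)%E; last first.
  apply: eq_integral => t _; rewrite /F patchE indicE.
  by case: (t \in E); rewrite ?mul1e ?mul0e.
rewrite ge0_integral_measure_series//; apply: eq_eseriesr => j _.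
rewrite ge0_integral_mrestr// integral_mkcond.
have [mcj c0j mgj g0j Hj] := H j.
(* The extra indicator of length [j] does not change [rounds_integral], which evaluates its argument
   on transcripts of length [j] only, and it matches the restriction in [M]. *)
pose Ej (t : T) := ((\1_(E `&` halted) t * \1_[set t | size t = j] t : R)%:E).
rewrite (@eq_rounds_integral _ _ _ Ej); last first.
  by move=> t tj; rewrite /Ej [X in _ * X]indicE mem_set// mulr1.
rewrite Hj.
- apply: eq_integral => t _; rewrite patchE /Ej !indicE.
  case: ifPn => [/set_mem /= tj|_]; last by rewrite mulr0 mul0e.
  rewrite mulr1 /F /c /g tj -!EFinM !indicE in_setI; congr EFin.
  by rewrite -/a -mulnb natrM !mulrA.
- apply/measurable_EFinP/measurable_funM; apply: measurable_indic.
    by apply: measurableI => //; exact: measurable_halt.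
  exact: measurable_size_transcript.
- by move=> t; rewrite lee_fin mulr_ge0.
Qed.

End transcript_density.

(** * Relative entropy of a product perturbation *)

Section likelihood.
Context (R : realType).

(** This is [ln (1 + u) >= u - 2 u^2] without the logarithm: [1 / (1 + u) <= 1 + (2 u^2 - u)] on
    this range, and [1 + y <= expR y]. *)
Lemma expR_le1D (u : R) : - 1 / 2 <= u -> expR (u - 2 * u ^+ 2) <= 1 + u.
Proof.
move=> u2; have y1 : 1 <= (1 + u) * (1 + (2 * u ^+ 2 - u)).
  have -> : (1 + u) * (1 + (2 * u ^+ 2 - u)) = 1 + u ^+ 2 * (1 + 2 * u) by lra.
  by rewrite lerDl mulr_ge0 ?sqr_ge0//; lra.
have u0 : 0 < 1 + u by lra.
rewrite -opprB expRN -[leRHS]invrK lef_pV2 ?posrE ?invr_gt0 ?expR_gt0//.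
apply: le_trans (expR_ge1Dx _).
by rewrite -[leLHS]mul1r ler_pdivrMr// mulrC.
Qed.

(** Approximate privacy keeps [q / p] in [[1/B, B]] only up to mass of order [delta]. Capping
    removes the excess above [B]; [shortfall] records the deficit below [1/B], which the upper cap
    cannot repair. *)
Definition capped (B p q : R) : R := if B * p < q then B * p else q.

Definition shortfall (B p q : R) : R := if B * q < p then p / B - q else 0.

(** For [r >= 1/B] the capped ratio is within [B - 1] of 1. Below, [1 - r = (1 - 1/B) + (1/B - r)]:
    the first part is at most [B - 1], and the second lies in [[0, 1]], so its square is at most
    itself, the shortfall. *)
Lemma sqr_capped_ratio (B r : R) : 1 <= B -> 0 <= r ->
  (capped B 1 r - 1) ^+ 2 <= 2 * (B - 1) ^+ 2 + 2 * shortfall B 1 r.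
Proof.
move=> B1 r0; have B0 : 0 < B by lra.
have Bv : B * B^-1 = 1 by rewrite divff// gt_eqF.
have Bv0 : 0 < B^-1 by rewrite invr_gt0.
have Bv1 : B^-1 <= 1 by rewrite invf_le1.
rewrite /capped /shortfall mulr1 div1r.
have [Br|rB] := ltP B r.
  have -> : (B * r < 1) = false by apply/negbTE; rewrite -leNgt mulr_ege1//; lra.
  by have := sqr_ge0 (B - 1); lra.
have r_lb : 0 <= B - 1 - (1 - B^-1).
  have BBv : B * (B * B^-1) = B by rewrite Bv mulr1.
  have -> : B - 1 - (1 - B^-1) = (B - 1) ^+ 2 * B^-1.
    by move: Bv BBv; set v := B^-1 => ? ?; lra.
  by rewrite mulr_ge0 ?sqr_ge0// ltW.
have [Br1|Br1] := ltP (B * r) 1.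
  have rBv : r <= B^-1 by rewrite -[leRHS]mul1r ler_pdivlMr// mulrC ltW.
  have h1 : (B^-1 - r) * (1 - (B^-1 - r)) >= 0 by rewrite mulr_ge0; lra.
  have h2 : (B - 1 - (1 - B^-1)) * (B - 1 + (1 - B^-1)) >= 0.
    by rewrite mulr_ge0//; lra.
  have h3 := sqr_ge0 ((1 - B^-1) - (B^-1 - r)).
  by nra.
have rBv : B^-1 <= r by rewrite -[leLHS]mul1r ler_pdivrMr// mulrC.
have sq0 := sqr_ge0 (B - 1).
rewrite mulr0 addr0; apply: (@le_trans _ _ ((B - 1) ^+ 2)); last by lra.
rewrite -real_normK ?num_real// ler_sqr ?nnegrE// ?ler_norml; last by lra.
by apply/andP; split; lra.
Qed.

(** A pointwise variational bound. With [r i = b i / a i], the mixture density is [p] times the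
    product of [1 + eta * (r i - 1)], which is at least [expR y] for a sum [y] of quadratic lower
    bounds in the capped ratios. The tangent inequality [y <= sigma - 1 + expR (y - sigma)] is
    multiplied by [p]; [sigma] is free and is later chosen according to the test event. *)
Lemma likelihood_sum_le N (a b : 'I_N -> R) (w p eta B sigma : R)
    (q : 'I_N -> R) :
  0 <= w -> (forall i, 0 <= a i) -> (forall i, 0 <= b i) ->
  0 <= eta <= 1 / 2 -> 1 <= B ->
  p = w * \prod_i a i ->
  (forall i, q i = w * (b i * \prod_(j | j != i) a j)) ->
  \sum_i (eta * (capped B p (q i) - p)
          - eta ^+ 2 * (4 * (B - 1) ^+ 2 * p + 4 * shortfall B p (q i)))
  <= p * (sigma - 1)
     + w * (\prod_i ((1 - eta) * a i + eta * b i)) * expR (- sigma).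
Proof.
move=> w0 a0 b0 /andP[eta0 eta1] B1 pE qdef.
have B0 : 0 < B by lra.
have p0 : 0 <= p by rewrite pE mulr_ge0 ?prodr_ge0.
have q0 i : 0 <= q i by rewrite qdef mulr_ge0 ?mulr_ge0 ?prodr_ge0.
have p1_ge0 : 0 <= w * \prod_i ((1 - eta) * a i + eta * b i).
  rewrite mulr_ge0//; apply: prodr_ge0 => i _.
  by rewrite addr_ge0// mulr_ge0//; lra.
(* The ratios [b i / a i] need every [a i] positive, which [p != 0] provides. At [p = 0] every term
   on the left vanishes. *)
have [pz|pn0] := eqVneq p 0.
  rewrite pz mul0r add0r big1 => [|i _].
    by apply: mulr_ge0; rewrite ?expR_ge0.
  rewrite /capped /shortfall mulr0.
  have -> : (B * q i < 0) = false by rewrite ltNge mulr_ge0 ?(ltW B0).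
  case: ltP => [_|qi]; first lra.
  have -> : q i = 0 by apply: le_anti; rewrite qi q0.
  by lra.
have pp : 0 < p by rewrite lt_def pn0.
have ai0 i : 0 < a i.
  rewrite lt_def a0 andbT; apply: contra_neq pn0 => ai.
  by rewrite pE (bigD1 i)//= ai mul0r mulr0.
pose r i := b i / a i.
have r0 i : 0 <= r i by rewrite divr_ge0.
have qE i : q i = p * r i.
  rewrite qdef pE /r [\prod_i a i](bigD1 i)//=.
  by rewrite -[in LHS](divfK (lt0r_neq0 (ai0 i)) (b i)); set v := b i / a i; lra.
pose u i := eta * (capped B 1 (r i) - 1).
have cap0 i : 0 <= capped B 1 (r i).
  by rewrite /capped; case: ifP => // _; rewrite mulr1 ltW.
have capr i : capped B 1 (r i) <= r i.
  by rewrite /capped; case: ifP => // /ltW.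
have u2 i : - 1 / 2 <= u i.
  by rewrite /u; have := cap0 i; nra.
have -> : w * \prod_i ((1 - eta) * a i + eta * b i)
    = p * \prod_i (1 + eta * (r i - 1)).
  rewrite pE -mulrA -big_split/=; congr (w * _); apply: eq_bigr => i _.
  rewrite -/(r i) -[in LHS](divfK (lt0r_neq0 (ai0 i)) (b i)) -/(r i).
  by lra.
set y := \sum_i (u i - 2 * u i ^+ 2).
have yle : expR y <= \prod_i (1 + eta * (r i - 1)).
  rewrite expR_sum; apply: ler_prod => i _; rewrite expR_ge0/=.
  apply: le_trans (expR_le1D (u2 i)) _.
  by rewrite lerD2l ler_wpM2l// lerD2r.
have H : p * y <= p * (sigma - 1) + p * \prod_i (1 + eta * (r i - 1)) * expR (- sigma).
  rewrite -mulrA -mulrDr ler_wpM2l//.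
  have := expR_ge1Dx (y - sigma); rewrite expRD => h1.
  have : expR y * expR (- sigma) <=
    \prod_i (1 + eta * (r i - 1)) * expR (- sigma) by rewrite ler_wpM2r ?expR_ge0.
  by lra.
apply: le_trans H; rewrite /y mulr_sumr; apply: ler_sum => i _.
have capE : capped B p (q i) = p * capped B 1 (r i).
  rewrite /capped qE (mulrC B p) ltr_pM2l// mulr1.
  by case: ifP.
have shE : shortfall B p (q i) = p * shortfall B 1 (r i).
  rewrite /shortfall qE mulrCA -[X in _ < X](mulr1 p) ltr_pM2l//.
  by case: ifP => _; rewrite ?mulr0//; lra.
rewrite capE shE /u.
have sq := sqr_capped_ratio B1 (r0 i).
set m := capped B 1 (r i) in sq *; set s := shortfall B 1 (r i) in sq *.
rewrite -subr_ge0.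
have -> : p * (eta * (m - 1) - 2 * (eta * (m - 1)) ^+ 2) -
   (eta * (p * m - p) - eta ^+ 2 * (4 * (B - 1) ^+ 2 * p + 4 * (p * s))) =
   2 * p * eta ^+ 2 * (2 * (B - 1) ^+ 2 + 2 * s - (m - 1) ^+ 2) by lra.
by rewrite mulr_ge0 ?subr_ge0// mulr_ge0 ?sqr_ge0// mulr_ge0.
Qed.

End likelihood.

Section integrals.
Context d (T : measurableType d) (R : realType) (M : {measure set T -> \bar R}).
Implicit Types (f : T -> R) (A : set T).

Lemma ge0_integrable f : measurable_fun setT f -> (forall t, 0 <= f t) ->
  (\int[M]_t (f t)%:E < +oo)%E -> M.-integrable setT (EFin \o f).
Proof.
move=> mf f0 fi; apply/integrableP; split; first exact/measurable_EFinP.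
by under eq_integral do rewrite /= ger0_norm//.
Qed.

Lemma integrable_mul_indic f A : measurable A ->
  M.-integrable setT (EFin \o f) ->
  M.-integrable setT (EFin \o (fun t => f t * \1_A t)).
Proof.
move=> mA fi.
have -> : EFin \o (fun t => f t * \1_A t) = (EFin \o f) \_ A.
  by apply/funext => t; rewrite patchE /= indicE; case: ifP => _;
    rewrite ?mulr1 ?mulr0.
by apply/(integrable_mkcond _ mA); apply: (integrableS measurableT).
Qed.

Lemma Rintegral_mul_indic f A :
  \int[M]_t (f t * \1_A t) = \int[M]_(t in A) f t.
Proof.
rewrite [RHS]Rintegral_mkcond; apply: eq_Rintegral => t _.
by rewrite patchE indicE; case: ifP => _; rewrite ?mulr1 ?mulr0.
Qed.

Lemma Rintegral_sum (I : Type) (s : seq I) (g : I -> T -> R) :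
  (forall i, M.-integrable setT (EFin \o g i)) ->
  M.-integrable setT (EFin \o (fun t => \sum_(i <- s) g i t)) /\
  \int[M]_t (\sum_(i <- s) g i t) = \sum_(i <- s) \int[M]_t g i t.
Proof.
move=> gi; elim: s => [|i s [IH1 IH2]].
  split.
    rewrite (_ : _ \o _ = cst 0%E); first exact: integrable0.
    by apply/funext => t; rewrite /= big_nil.
  by under eq_Rintegral do rewrite big_nil; rewrite big_nil Rintegral_cst// mul0r.
split.
  rewrite (_ : _ \o _ = (EFin \o g i) \+ (EFin \o (fun t => \sum_(i <- s) g i t))).
    exact: integrableD.
  by apply/funext => t; rewrite /= big_cons.
under eq_Rintegral do rewrite big_cons.
by rewrite RintegralD// IH2 big_cons.
Qed.

End integrals.

(* [p], [q i] and [p1] are the densities of the transcript when all bits are 0,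
   when only bit [i] is 1, and when the bits are independent Bernoulli [eta]. *)
Section divergence.
Context d (T : measurableType d) (R : realType) (M : {measure set T -> \bar R}).
Variables (N : nat) (w : T -> R) (a b : 'I_N -> T -> R).
Variables (eta B delta : R).
Hypotheses (mw : measurable_fun setT w) (w0 : forall t, 0 <= w t)
  (ma : forall i, measurable_fun setT (a i)) (a0 : forall i t, 0 <= a i t)
  (mb : forall i, measurable_fun setT (b i)) (b0 : forall i t, 0 <= b i t).
Hypotheses (eta01 : 0 <= eta <= 1 / 2) (B1 : 1 <= B).

Let p t := w t * \prod_i a i t.
Let q i t := w t * (b i t * \prod_(j | j != i) a j t).
Let p1 t := w t * \prod_i ((1 - eta) * a i t + eta * b i t).

Hypotheses (intp : (\int[M]_t (p t)%:E = 1)%E)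
  (intq : forall i, (\int[M]_t (q i t)%:E = 1)%E)
  (intp1 : (\int[M]_t (p1 t)%:E = 1)%E).
Hypothesis pq_close : forall i A, measurable A ->
  \int[M]_(t in A) p t <= B * \int[M]_(t in A) q i t + delta.
Hypothesis qp_close : forall i A, measurable A ->
  \int[M]_(t in A) q i t <= B * \int[M]_(t in A) p t + delta.

Let p_ge0 t : 0 <= p t. Proof. by rewrite mulr_ge0 ?prodr_ge0. Qed.
Let q_ge0 i t : 0 <= q i t. Proof. by rewrite !mulr_ge0 ?prodr_ge0. Qed.
Let p1_ge0 t : 0 <= p1 t.
Proof.
have /andP[? ?] := eta01; rewrite mulr_ge0//; apply: prodr_ge0 => i _.
by rewrite addr_ge0// mulr_ge0//; lra.
Qed.
Let mp : measurable_fun setT p.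
Proof. by apply: measurable_funM => //; exact: measurable_prod. Qed.
Let mq i : measurable_fun setT (q i).
Proof.
do 2 apply: measurable_funM => //.
by under eq_fun do rewrite -big_filter; exact: measurable_prod.
Qed.
Let mp1 : measurable_fun setT p1.
Proof.
apply: measurable_funM => //; apply: measurable_prod => i _.
by apply: measurable_funD; apply: measurable_funM.
Qed.

Let ip : M.-integrable setT (EFin \o p).
Proof. by apply: ge0_integrable => //; rewrite intp ltry. Qed.
Let iq i : M.-integrable setT (EFin \o q i).
Proof. by apply: ge0_integrable => //; rewrite intq ltry. Qed.
Let ip1 : M.-integrable setT (EFin \o p1).
Proof. by apply: ge0_integrable => //; rewrite intp1 ltry. Qed.

Let phi i t := eta * (capped B (p t) (q i t) - p t)
  - eta ^+ 2 * (4 * (B - 1) ^+ 2 * p t + 4 * shortfall B (p t) (q i t)).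

Let iZ (c : R) f : M.-integrable setT (EFin \o f) ->
  M.-integrable setT (EFin \o (fun t => c * f t)).
Proof.
by move=> fi; exact: (integrableZl measurableT c fi).
Qed.
Let iD f g : M.-integrable setT (EFin \o f) -> M.-integrable setT (EFin \o g) ->
  M.-integrable setT (EFin \o (fun t => f t + g t)).
Proof. by move=> fi gi; exact: (integrableD measurableT fi gi). Qed.

(** Since [p] and [q i] both have mass 1, the linear term loses only the mass removed by the cap,
    [q(A) - B p(A) <= delta]. The shortfall integrates to [p(A') / B - q(A') <= delta]. *)
Let phi_int i : M.-integrable setT (EFin \o phi i) /\
  - (eta * delta + eta ^+ 2 * (4 * (B - 1) ^+ 2 + 4 * delta)) <= \int[M]_t phi i t.
Proof.
have /andP[e0 e1] := eta01.
have B0 : 0 < B by apply: lt_le_trans B1.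
pose A := [set t | B * p t < q i t]; pose A' := [set t | B * q i t < p t].
have mA : measurable A.
  rewrite /A -[X in measurable X]setTI; apply: measurable_fun_ltr => //.
  exact: measurable_funM.
have mA' : measurable A'.
  rewrite /A' -[X in measurable X]setTI; apply: measurable_fun_ltr => //.
  exact: measurable_funM.
have phiE t : phi i t = eta * q i t + (- eta) * (q i t * \1_A t)
    + eta * B * (p t * \1_A t) + (- eta - 4 * eta ^+ 2 * (B - 1) ^+ 2) * p t
    + (- (4 * eta ^+ 2) / B) * (p t * \1_A' t)
    + (4 * eta ^+ 2) * (q i t * \1_A' t).
  rewrite /phi /capped /shortfall !indicE.
  have [h|h] := ltP (B * p t) (q i t); have [h'|h'] := ltP (B * q i t) (p t);
    rewrite ?(mem_set (h : A t)) ?(mem_set (h' : A' t))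
      ?(@memNset _ A) ?(@memNset _ A') //=;
    rewrite /A /A' /= ?ltNge ?h ?h' //; set v := B^-1; lra.
have ipA := integrable_mul_indic mA ip.
have iqA := integrable_mul_indic mA (iq i).
have ipA' := integrable_mul_indic mA' ip.
have iqA' := integrable_mul_indic mA' (iq i).
have RT f (c : R) : (\int[M]_t (f t)%:E = c%:E)%E -> \int[M]_t f t = c.
  by rewrite /Rintegral => ->.
rewrite (funext phiE); split; first by do ! apply: iD; exact: iZ.
rewrite !RintegralD//; try (by exact: iZ); try by do ! apply: iD; exact: iZ.
rewrite !RintegralZl// !Rintegral_mul_indic (RT _ _ intp) (RT _ _ (intq i)).
have h1 := qp_close i mA; have h2 := pq_close i mA'.
move: h1 h2.
set qA := \int[M]_(t in A) q i t; set pA := \int[M]_(t in A) p t.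
set qA' := \int[M]_(t in A') q i t; set pA' := \int[M]_(t in A') p t => h1 h2.
have h3 : pA' / B <= qA' + delta.
  rewrite ler_pdivrMr// (le_trans h2)// mulrDl (mulrC qA') lerD2l.
  have d0 : 0 <= delta.
    have := qp_close i measurable0.
    by rewrite !Rintegral_set0 mulr0 add0r.
  by rewrite ler_peMr.
have h4 : 0 <= eta * (B * pA + delta - qA) by rewrite mulr_ge0// subr_ge0.
have h5 : 0 <= 4 * eta ^+ 2 * (qA' + delta - pA' / B).
  by rewrite mulr_ge0 ?subr_ge0// mulr_ge0 ?sqr_ge0.
rewrite -subr_ge0.
have -> : - (4 * eta ^+ 2) / B * pA' = - (4 * eta ^+ 2 * (pA' / B)).
  by lra.
by lra.
Qed.

(* The log-likelihood ratio of [p1] against [p] is the sum over [i] of those of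
   the mixtures [(1 - eta) * p + eta * q i] against [p], so the relative entropies
   from [p] add up; each one is quadratic in [eta]. *)
Lemma divergence_bound (E : set T) : measurable E ->
  2 / 3 <= \int[M]_(t in E) p t ->
  1 / 3 <= N%:R * (eta * delta + eta ^+ 2 * (4 * (B - 1) ^+ 2 + 4 * delta))
          + 7 / 9 * \int[M]_(t in E) p1 t.
Proof.
move=> mE pE.
have iphi i := (phi_int i).1.
have [isum sumE] := Rintegral_sum (index_enum 'I_N) iphi.
(* [sigma] is [- 1/2] on [E] and 0 elsewhere, and [h] bounds [expR (1/2)] because
   [expR (- 1/4) >= 3/4]. The upper bound integrates to [- p(E) / 2 + (h - 1) p1(E)], hence the 1/3
   (half of 2/3) and the 7/9. *)
pose h : R := 16 / 9.
have h12 : expR (1 / 2) <= h.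
  rewrite (_ : 1 / 2 = - (- 1 / 4 + - 1 / 4)); last by lra.
  rewrite expRN expRD -[leRHS]invrK lef_pV2 ?posrE ?mulr_gt0 ?expR_gt0//;
    last by rewrite invr_gt0 /h; lra.
  have := expR_ge1Dx (- 1 / 4 : R) => h4.
  rewrite (_ : h^-1 = (3 / 4) * (3 / 4)); last by rewrite /h; lra.
  by apply: ler_pM => //; lra.
pose psi (t : T) : R := - (1 / 2) * (p t * \1_E t) + (-1) * p t
  + (h - 1) * (p1 t * \1_E t) + 1 * p1 t.
have ipE := integrable_mul_indic mE ip.
have ip1E := integrable_mul_indic mE ip1.
have ipsi : M.-integrable setT (EFin \o psi) by do ! apply: iD; exact: iZ.
have le t : \sum_i phi i t <= psi t.
  have [Et|Et] := pselect (E t).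
    apply: le_trans (likelihood_sum_le (- (1 / 2)) (w0 t) (a0^~ t) (b0^~ t)
      eta01 B1 erefl (fun i => erefl)) _.
    have le1 : p1 t * expR (1 / 2) <= p1 t * h by exact: ler_wpM2l.
    rewrite opprK -/(p t) /psi indicE mem_set//= !mulr1.
    have {}le1 : w t * (\prod_i ((1 - eta) * a i t + eta * b i t)) * expR (1 / 2)
      <= p1 t * h by exact: le1.
    by lra.
  apply: le_trans (likelihood_sum_le 0 (w0 t) (a0^~ t) (b0^~ t)
      eta01 B1 erefl (fun i => erefl)) _.
  rewrite oppr0 expR0 -/(p t) -/(p1 t) /psi indicE memNset//= !mulr0.
  by lra.
have := le_Rintegral measurableT isum ipsi (fun t _ => le t).
rewrite sumE.
have -> : \int[M]_t psi t = - (1 / 2) * \int[M]_(t in E) p t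
    + (h - 1) * \int[M]_(t in E) p1 t.
  have i1 := iZ (- (1 / 2)) ipE; have i2 := iZ (-1) ip.
  have i3 := iZ (h - 1) ip1E; have i4 := iZ 1 ip1.
  rewrite /psi (RintegralD measurableT (iD (iD i1 i2) i3) i4).
  rewrite (RintegralD measurableT (iD i1 i2) i3) (RintegralD measurableT i1 i2).
  rewrite (RintegralZl _ measurableT ipE) (RintegralZl _ measurableT ip).
  rewrite (RintegralZl _ measurableT ip1E) (RintegralZl _ measurableT ip1).
  rewrite !Rintegral_mul_indic /Rintegral intp intp1 /=.
  by lra.
have : N%:R * - (eta * delta + eta ^+ 2 * (4 * (B - 1) ^+ 2 + 4 * delta))
    <= \sum_i \int[M]_t phi i t.
  rewrite mulr_natl -[X in _ *+ X]card_ord -sumr_const.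
  by apply: ler_sum => i _; exact: (phi_int i).2.
rewrite mulrN /h => h1 h2.
set X := N%:R * _ in h1 *; set P := \int[M]_(t in E) p t in pE h2.
set Q := \int[M]_(t in E) p1 t in h2 *; set S := \sum_(i < N) _ in h1 h2.
by lra.
Qed.

End divergence.

(** * Graphs *)

Section graphs.
Local Open Scope set_scope.
Local Open Scope nat_scope.
Variable n : nat.
Implicit Types G : graph n.

Definition graph_of (r : rel 'I_n) : graph n.
Proof.
refine (@Graph n (fun u v => (u != v) && (r u v || r v u)) _ _).
- by move=> u v; rewrite eq_sym orbC.
- by move=> u; rewrite eqxx.
Defined.

Definition edge_dist G G' : nat :=
  #|[pred e : 'I_n * 'I_n | (e.1 < e.2) && (adj G e.1 e.2 != adj G' e.1 e.2)]|.

Lemma edge_dist0_adj G G' : edge_dist G G' = 0 -> adj G =2 adj G'.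
Proof.
move=> /card0_eq d0 u v; apply/eqP; apply/negPn/negP => uv.
have [lt|lt|/val_inj e] := ltngtP u v.
- by have := d0 (u, v); rewrite inE /= lt uv.
- by have := d0 (v, u); rewrite inE /= lt !(adj_sym _ v) uv.
- by move: uv; rewrite e !adj_irr.
Qed.

Definition toggle G (e : 'I_n * 'I_n) (lt_e : e.1 < e.2) : graph n.
Proof.
refine (@Graph n (fun u v =>
  adj G u v (+) (((u, v) == e) || ((v, u) == e))) _ _).
- by move=> u v; rewrite adj_sym orbC.
- move=> u; rewrite adj_irr orbb /=; apply/negP => /eqP ue.
  by move: lt_e; rewrite -ue ltnn.
Defined.

Lemma adj_toggle G (e : 'I_n * 'I_n) (lt_e : e.1 < e.2) (f : 'I_n * 'I_n) : f.1 < f.2 ->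
  adj (toggle G lt_e) f.1 f.2 = adj G f.1 f.2 (+) (f == e).
Proof.
case: f => u v /= uv; congr (_ (+) _).
suff -> : ((v, u) == e) = false by rewrite orbF.
by apply/negP => /eqP ve; move: lt_e; rewrite -ve /= ltnNge (ltnW uv).
Qed.

Lemma toggle_neighbors G (e : 'I_n * 'I_n) (lt_e : e.1 < e.2) :
  edge_neighbors G (toggle G lt_e).
Proof.
rewrite /edge_neighbors -(card1 e); apply: eq_card => f; rewrite !inE.
have [lt_f|] := ltnP; last first.
  by move=> ge; apply/esym/negP => /eqP fe; move: ge; rewrite fe leqNgt lt_e.
by rewrite adj_toggle//=; case: (f == e); case: (adj G f.1 f.2).
Qed.

Lemma edge_dist_toggle G G' (e : 'I_n * 'I_n) (lt_e : e.1 < e.2) :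
  adj G e.1 e.2 != adj G' e.1 e.2 ->
  edge_dist G G' = (edge_dist (toggle G lt_e) G').+1.
Proof.
move=> ne; rewrite /edge_dist (cardD1 e) inE lt_e ne add1n; congr _.+1.
apply: eq_card => f; rewrite !inE.
have [lt_f|] := ltnP f.1 f.2; last by rewrite andbF.
rewrite adj_toggle//=; have [->|] := eqVneq f e; last by rewrite addbF.
by rewrite addbT; move: ne; case: (adj G _ _); case: (adj G' _ _).
Qed.

Definition triangle_set G : {set {set 'I_n}} :=
  [set T : {set 'I_n} |
    (#|T| == 3) && [forall i in T, forall j in T, (i != j) ==> adj G i j]].

Lemma trianglesE G : triangles G = #|triangle_set G|.
Proof. by apply: eq_card => T; rewrite !inE. Qed.

Lemma triangle_setP G (T : {set 'I_n}) :
  reflect (#|T| = 3 /\ {in T &, forall i j, i != j -> adj G i j})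
          (T \in triangle_set G).
Proof.
rewrite inE; apply: (iffP andP) => -[/eqP T3 adjT]; split => //.
- move=> i j iT jT ij.
  by move/forall_inP: adjT => /(_ i iT)/forall_inP/(_ j jT)/implyP; exact.
- apply/forall_inP => i iT; apply/forall_inP => j jT; apply/implyP.
  exact: adjT.
Qed.

(** On a triangle [f] would be injective into the two booleans. *)
Lemma triangles_bipartite G (f : 'I_n -> bool) :
  (forall u v, adj G u v -> f u != f v) -> triangles G = 0.
Proof.
move=> fG; rewrite trianglesE; apply: eq_card0 => T; apply/negP.
move=> /triangle_setP[T3 adjT].
have finj : {in T &, injective f}.
  move=> u v uT vT fuv; apply/eqP/negPn/negP => uv.
  by have := fG _ _ (adjT _ _ uT vT uv); rewrite fuv eqxx.
have := card_in_imset finj; rewrite T3 => f3.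
by have := max_card (mem (f @: T)); rewrite f3 card_bool.
Qed.

Lemma triangles_lt G G' (u v w : 'I_n) :
  (forall i j, adj G i j -> adj G' i j) ->
  adj G' u v -> adj G' v w -> adj G' u w -> ~~ adj G u v ->
  triangles G < triangles G'.
Proof.
move=> GG' uv vw uw nuv.
have neq i j : adj G' i j -> i != j.
  by move=> ij; apply/eqP => e; move: ij; rewrite e adj_irr.
have [uv' vw' uw'] := And3 (neq _ _ uv) (neq _ _ vw) (neq _ _ uw).
rewrite !trianglesE; apply: proper_card; apply/fintype.properP; split.
  apply/fintype.subsetP => T /triangle_setP[T3 adjT]; apply/triangle_setP; split => //.
  by move=> i j iT jT ij; apply: GG'; exact: adjT.
exists [set u; v; w].
  apply/triangle_setP; split.
    by rewrite finset.setUC cardsU1 !inE negb_or eq_sym uw' eq_sym vw' /= cards2 uv'.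
  have [vu wv wu] : [/\ adj G' v u, adj G' w v & adj G' w u].
    by rewrite ![adj _ v u]adj_sym ![adj _ w _]adj_sym.
  by move=> i j; rewrite !inE -!orbA => /or3P[]/eqP-> /or3P[]/eqP-> //;
    rewrite eqxx.
apply/negP => /triangle_setP[_ /(_ u v)].
by rewrite !inE !eqxx /= orbT => /(_ isT isT uv'); rewrite (negbTE nuv).
Qed.

Lemma triangles_complete : triangles (graph_of (fun _ _ => true)) = 'C(n, 3).
Proof.
rewrite trianglesE -[in RHS](card_ord n) -card_draws; apply: eq_card => T.
apply/triangle_setP/idP; rewrite inE; first by case=> ->.
by move=> /eqP T3; split => // i j _ _ ij /=; rewrite ij.
Qed.

Lemma edge_dist_max G G' : edge_dist G G' <= n ^ 2.
Proof.
rewrite -mulnn -[X in X * _]card_ord -[X in _ * X]card_ord -card_prod.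
exact: max_card.
Qed.

End graphs.

(** * The hard instances *)

Section group_graphs.
Local Open Scope set_scope.
Local Open Scope nat_scope.
Variables (n N s : nat).
Hypothesis (s0 : 0 < s) (Nn : N * s.*2 <= n).
Local Notation t := s.*2.
Let t0 : 0 < t. Proof. by rewrite double_gt0. Qed.

(* The first [N] blocks of [2s] consecutive nodes are the groups. *)
Definition group_of (v : 'I_n) : option 'I_N := insub (v %/ t).

Definition group_graph (x : 'I_N -> bool) : graph n :=
  graph_of (fun u v => match group_of u, group_of v with
    | Some i, Some j => (i == j) && x i
    | Some _, None => true
    | None, _ => false end).

(** With [adj_row_no_group] this is the locality behind the factorization by groups: a grouped node
    sees only its own group's bit, and an outside node sees none. *)
Lemma adj_row_group (x : 'I_N -> bool) v i : group_of v = Some i ->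
  adj_row (group_graph x) v = adj_row (group_graph (fun=> x i)) v.
Proof.
move=> vi; apply/ffunP => u; rewrite !ffunE /= vi; congr (_ && _).
by case: (group_of u) => // j; rewrite [j == i]eq_sym; case: eqP => [->|].
Qed.

Lemma adj_row_no_group (x y : 'I_N -> bool) v : group_of v = None ->
  adj_row (group_graph x) v = adj_row (group_graph y) v.
Proof. by move=> vN; apply/ffunP => u; rewrite !ffunE /= vN; case: group_of. Qed.

Lemma triangles_group_graph0 : triangles (group_graph (fun=> false)) = 0.
Proof.
apply: (@triangles_bipartite _ _ (fun v => isSome (group_of v))) => u v /=.
by case: (group_of u) => [i|]; case: (group_of v) => [j|]; rewrite ?andbF.
Qed.

Lemma card_group i : #|[set v : 'I_n | group_of v == Some i]| <= t.
Proof.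
rewrite -[X in _ <= X]card_ord.
pose f (v : 'I_n) : 'I_t := Ordinal (ltn_pmod v t0).
rewrite -(@card_in_imset _ _ f) ?max_card// => u v; rewrite !inE /group_of.
move=> /eqP ui /eqP vi /(congr1 val)/= uv; apply: val_inj => /=.
rewrite (divn_eq u t) (divn_eq v t) uv; congr (_ * _ + _).
move: ui vi; case: insubP => // j _ jE; case: insubP => // k _ kE.
by move=> [ji] [ki]; rewrite -jE -kE ji ki.
Qed.

Lemma edge_dist_group_graph i :
  edge_dist (group_graph (fun=> false)) (group_graph (pred1 i)) <= t ^ 2.
Proof.
pose V := [set v : 'I_n | group_of v == Some i].
apply: (@leq_trans #|finset.setX V V|); last first.
  by rewrite cardsX -mulnn leq_mul// card_group.
apply: subset_leq_card; apply/fintype.subsetP => -[u v]; rewrite !inE /=.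
move=> /andP[_]; case: (u != v) => //=.
case: (group_of u) => [j|]; case: (group_of v) => [k|] //.
rewrite !andbF /= [k == j]eq_sym; have [->|] := eqVneq j k => //=.
by rewrite orbb; case: (eqVneq k i) => [->|] //; rewrite !eqxx.
Qed.

(** For each set bit, one node from the first half of the group, one from the second half and one
    outside node form a triangle. Using the two halves makes the choice recoverable from the
    triangle, by quotients and residues modulo [2s], so nothing is counted twice. *)
Lemma triangles_group_graph (x : 'I_N -> bool) :
  #|[set i | x i]| * s * s * (n - N * t) <= triangles (group_graph x).
Proof.
set m := n - N * t.
pose U (p : 'I_N * 'I_s * 'I_s * 'I_m) := p.1.1.1 * t + p.1.1.2.
pose V (p : 'I_N * 'I_s * 'I_s * 'I_m) := p.1.1.1 * t + (s + p.1.2).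
pose W (p : 'I_N * 'I_s * 'I_s * 'I_m) := N * t + p.2.
have st (a : 'I_s) : a < t by have := ltn_ord a; lia.
have st' (a : 'I_s) : s + a < t by have := ltn_ord a; lia.
have Udiv p : U p %/ t = p.1.1.1 by rewrite /U divnMDl// divn_small// addn0.
have Vdiv p : V p %/ t = p.1.1.1 by rewrite /V divnMDl// divn_small// addn0.
have Wdiv p : N <= W p %/ t by rewrite /W divnMDl// leq_addr.
have UN p : U p < N * t by rewrite -ltn_divLR// Udiv.
have VN p : V p < N * t by rewrite -ltn_divLR// Vdiv.
have Un p : U p < n by exact: leq_trans (UN p) Nn.
have Vn p : V p < n by exact: leq_trans (VN p) Nn.
have Wn p : W p < n.
  by have := ltn_ord p.2; rewrite -(ltn_add2l (N * t)) [X in _ < X]subnKC.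
have UV p : U p < V p by rewrite /U /V; have := ltn_ord p.1.1.2; lia.
have VW p : V p < W p by rewrite (leq_trans (VN p))// leq_addr.
pose T p : {set 'I_n} := [set Ordinal (Un p); Ordinal (Vn p); Ordinal (Wn p)].
have memT p (z : 'I_n) : (z \in T p) = (val z \in [:: U p; V p; W p]).
  by rewrite !inE -!val_eqE /= orbA.
have Tinj : injective T.
  move=> p p' TE.
  have mem z (zn : z < n) : (z \in [:: U p; V p; W p]) = (z \in [:: U p'; V p'; W p']).
    by have := memT p (Ordinal zn); rewrite TE memT.
  have mW := mem _ (Wn p); have mU := mem _ (Un p); have mV := mem _ (Vn p).
  have modU q : U q %% t = q.1.1.2 by rewrite /U modnMDl modn_small.
  have modV q : V q %% t = s + q.1.2 by rewrite /V modnMDl modn_small.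
  have UpVp' : U p != V p'.
    apply/eqP => /(congr1 (modn^~ t)); rewrite modU modV.
    by have := ltn_ord p.1.1.2; lia.
  have VpUp' : V p != U p'.
    apply/eqP => /(congr1 (modn^~ t)); rewrite modU modV.
    by have := ltn_ord p'.1.1.2; lia.
  have WE : W p = W p'.
    move: mW; rewrite !inE eqxx !orbT => /esym/or3P[]/eqP //.
      by have := UN p'; have := leq_addr p.2 (N * t); rewrite -/(W p); lia.
    by have := VN p'; have := leq_addr p.2 (N * t); rewrite -/(W p); lia.
  have UE : U p = U p'.
    move: mU; rewrite !inE eqxx (negbTE UpVp') /= => /esym/orP[/eqP//|/eqP].
    by have := UV p; have := VW p; lia.
  have VE : V p = V p'.
    move: mV; rewrite !inE eqxx (negbTE VpUp') /= orbT => /esym/orP[/eqP//|/eqP].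
    by have := VW p; lia.
  move: (congr1 (divn^~ t) UE) (congr1 (modn^~ t) UE) (congr1 (modn^~ t) VE) WE.
  rewrite !Udiv !modU !modV /W.
  case: p {mem mW mU mV UpVp' VpUp' UE VE TE} => -[[i a] b] c.
  case: p' => -[[i' a'] b'] c' /= /val_inj-> /val_inj-> /addnI/val_inj->.
  by move=> /addnI/val_inj->.
pose D := finset.setX (finset.setX (finset.setX [set i | x i] [set: 'I_s])
  [set: 'I_s]) [set: 'I_m].
have <- : #|D| = #|[set i | x i]| * s * s * m by rewrite !cardsX !cardsT !card_ord.
rewrite -(card_imset (mem D) Tinj) trianglesE; apply: subset_leq_card.
apply/fintype.subsetP => _ /imsetP[p pD ->].
have xp : x p.1.1.1 by move: pD; rewrite !inE !andbT.
have gU z : val z = U p -> group_of z = Some p.1.1.1.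
  by move=> zE; rewrite /group_of zE Udiv valK.
have gV z : val z = V p -> group_of z = Some p.1.1.1.
  by move=> zE; rewrite /group_of zE Vdiv valK.
have gW z : val z = W p -> group_of z = None.
  by move=> zE; rewrite /group_of zE insubN// -leqNgt.
apply/triangle_setP; split.
  rewrite /T finset.setUC cardsU1 cards2 !inE -!val_eqE /=.
  by rewrite (ltn_eqF (UV p)) (gtn_eqF (VW p)) (gtn_eqF (ltn_trans (UV p) (VW p))).
move=> i j; rewrite !memT !inE => /or3P[]/eqP iE /or3P[]/eqP jE ij /=;
  rewrite ij /= ?(gU i iE) ?(gV i iE) ?(gW i iE) ?(gU j jE) ?(gV j jE)
    ?(gW j jE) ?eqxx ?xp //.
by move: ij; rewrite -val_eqE iE jE eqxx.
Qed.

End group_graphs.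

(** * Consequences of privacy *)

Section laws.
Context (R : realType) (n : nat) d (Y : measurableType d).
Variables (A : local_algorithm R n Y) (eps delta : R).
Hypotheses (A_halts : halts A) (A_ledp : LEDP eps delta A).
Hypotheses (eps0 : 0 <= eps) (delta0 : 0 <= delta).
Local Notation T := (transcript n Y).
Implicit Types (G : graph n) (E : set T).

Definition law G E : R := fine (transcript_law A G E).

Lemma lawE G E : measurable E -> transcript_law A G E = (law G E)%:E.
Proof.
move=> mE; have [M [c [g [mc c0 mg g0 ME]]]] := transcript_law_density A.
rewrite /law fineK// ge0_fin_numE; last first.
  rewrite ME//; apply: integral_ge0 => t _.
  by rewrite lee_fin mulr_ge0 ?prodr_ge0.
apply: (@le_lt_trans _ _ (transcript_law A G setT)); last first.
  by rewrite A_halts ltry.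
rewrite !ME//; apply: ge0_subset_integral => //.
- by apply/measurable_EFinP/measurable_funM => //; exact: measurable_prod.
- by move=> t _; rewrite lee_fin mulr_ge0 ?prodr_ge0.
Qed.

Lemma law_ge0 G E : measurable E -> 0 <= law G E.
Proof.
move=> mE; have [M [c [g [mc c0 mg g0 ME]]]] := transcript_law_density A.
rewrite -lee_fin -lawE// ME//; apply: integral_ge0 => t _.
by rewrite lee_fin mulr_ge0 ?prodr_ge0.
Qed.

Lemma lawU G E E' : measurable E -> measurable E' -> E `&` E' = set0 ->
  law G (E `|` E') = law G E + law G E'.
Proof.
move=> mE mE' EE'; have mU := measurableU _ _ mE mE'.
have [M [c [g [mc c0 mg g0 ME]]]] := transcript_law_density A.
apply: EFin_inj; rewrite EFinD -!lawE// !ME// ge0_integral_setU//.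
- apply/measurable_EFinP; apply: measurable_funTS.
  by apply: measurable_funM => //; exact: measurable_prod.
- by move=> t _; rewrite lee_fin mulr_ge0 ?prodr_ge0.
- by apply/disj_setPS; rewrite EE'.
Qed.

Lemma law_le1 G E : measurable E -> law G E <= 1.
Proof.
move=> mE; have : law G setT = 1 by rewrite /law A_halts.
rewrite -(setUv E) lawU ?setICr//; last exact: measurableC.
by move=> <-; rewrite lerDl law_ge0//; exact: measurableC.
Qed.

Lemma law_disjoint G E E' : measurable E -> measurable E' -> E `&` E' = set0 ->
  law G E + law G E' <= 1.
Proof.
by move=> mE mE' EE'; rewrite -lawU// law_le1//; exact: measurableU.
Qed.

Lemma eq_law G G' E : measurable E -> adj G =2 adj G' -> law G E = law G' E.
Proof.
move=> mE GG'; have [M [c [g [mc c0 mg g0 ME]]]] := transcript_law_density A.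
rewrite /law !ME//; congr fine; apply: eq_integral => t _.
congr (_ * _)%:E; apply: eq_bigr => i _; congr (g i _ t).
by apply/ffunP => j; rewrite !ffunE GG'.
Qed.

Lemma law_ledp G G' E : measurable E -> edge_neighbors G G' ->
  law G E <= expR eps * law G' E + delta.
Proof.
move=> mE GG'; have := A_ledp GG' mE.
by rewrite (lawE G mE) (lawE G' mE) -EFinM -EFinD lee_fin.
Qed.

(** The differing edges are flipped one at a time. Each flip adds one [delta], which the other flips
    amplify by at most [expR (k * eps)]. *)
Lemma group_privacy k G G' E : measurable E -> (edge_dist G G' <= k)%N ->
  law G E <= expR (k%:R * eps) * law G' E + k%:R * expR (k%:R * eps) * delta.
Proof.
move=> mE; elim: k G => [|k IH] G.
  rewrite leqn0 => /eqP/edge_dist0_adj/(eq_law mE) ->.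
  by rewrite !mul0r expR0 mul1r addr0.
have [/edge_dist0_adj/(eq_law mE) -> _|] := eqVneq (edge_dist G G') 0%N.
  have e1 : 1 <= expR (k.+1%:R * eps).
    by apply: le_trans (expR_ge1Dx _); rewrite lerDl mulr_ge0.
  rewrite ler_wpDr ?mulr_ge0 ?expR_ge0//.
  by rewrite ler_peMl// law_ge0.
rewrite -lt0n => /card_gt0P[e]; rewrite inE => /andP[lt_e ne].
rewrite (edge_dist_toggle lt_e ne) ltnS => /IH IHk.
apply: le_trans (law_ledp mE (toggle_neighbors G lt_e)) _.
have ek : expR (k.+1%:R * eps) = expR eps * expR (k%:R * eps).
  by rewrite -expRD mulrS mulrDl mul1r.
have h : expR eps * law (toggle G lt_e) E <= expR eps *
   (expR (k%:R * eps) * law G' E + k%:R * expR (k%:R * eps) * delta).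
  by rewrite ler_wpM2l// expR_ge0.
have e1 : 1 <= expR (k.+1%:R * eps).
  by apply: le_trans (expR_ge1Dx _); rewrite lerDl mulr_ge0.
have h2 : delta <= expR (k.+1%:R * eps) * delta by rewrite ler_peMl.
apply: le_trans (lerD h h2) _; rewrite ek.
rewrite -natr1 le_eqVlt; apply/orP; left; apply/eqP; lra.
Qed.

Section estimator.
Variables (est : T -> R) (alpha : R).
Hypothesis mest : measurable_fun setT est.
Hypothesis A_approx : approximates_triangles setT alpha A est.

Definition near_count (k : nat) : set T := [set h | `|est h - k%:R| <= alpha].

Lemma measurable_near_count k : measurable (near_count k).
Proof.
rewrite /near_count -[X in measurable X]setTI.
apply: measurable_fun_le => //.
by apply: measurableT_comp => //; exact: measurable_funB.
Qed.

Lemma law_near_count G : 2 / 3 <= law G (near_count (triangles G)).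
Proof.
have := A_approx I (G := G).
by rewrite -/(near_count _) lawE ?lee_fin//; exact: measurable_near_count.
Qed.

Lemma near_count_disjoint k k' : 2 * alpha < k'%:R - k%:R ->
  near_count k `&` near_count k' = set0.
Proof.
move=> kk'; apply/seteqP; split => // h [] /=; rewrite /near_count /= !ler_norml.
by move=> /andP[? ?] /andP[? ?]; lra.
Qed.

(** 15 is the least [n] with ['C(n, 3) > 2 * n ^ 2], so that even error [n ^ 2] separates the
    complete graph from the empty one. *)
Lemma complete_empty_bound : (15 <= n)%N -> alpha <= n%:R ^+ 2 ->
  2 / 3 <= expR ((n ^ 2)%:R * eps) / 3
           + (n ^ 2)%:R * expR ((n ^ 2)%:R * eps) * delta.
Proof.
move=> n15 alphan.
pose G1 := graph_of (fun _ _ : 'I_n => true).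
pose G0 := graph_of (fun _ _ : 'I_n => false).
have T0 : triangles G0 = 0%N.
  by apply: (@triangles_bipartite _ _ (fun=> true)) => u v /=; rewrite andbF.
have gap : 2 * alpha < (triangles G1)%:R - (triangles G0)%:R.
  rewrite triangles_complete T0 subr0.
  apply: (@le_lt_trans _ _ (2 * n%:R ^+ 2)); first by rewrite ler_pM2l.
  rewrite -natrX -natrM ltr_nat.
  have := bin_ffact n 3; rewrite !ffactnS ffactn0 muln1 => h.
  rewrite (_ : 3`! = 6)%N// in h.
  by move: h n15; case: n => [//|[//|m]] /=; nia.
have h1 := law_near_count G1; have h0 := law_near_count G0.
have h2 := law_disjoint G0 (measurable_near_count (triangles G0))
  (measurable_near_count (triangles G1)) (near_count_disjoint gap).
apply: le_trans h1 _.
apply: le_trans (group_privacy (measurable_near_count _) (edge_dist_max G1 G0)) _.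
rewrite lerD2r; apply: ler_wpM2l; first exact: expR_ge0.
move: h0 h2; set P := law G0 _; set Q := law G0 _ => h0 h2.
by rewrite -div1r; lra.
Qed.

(** The middle graph leaves mass at most 1/3 for the answers of both its neighbors together, which
    yields the 6. Two graphs would give only [2/3 <= expR eps / 3 + delta], no contradiction for
    [eps] near 1. *)
Lemma three_graphs_bound : (4 <= n)%N -> alpha < 1 / 2 ->
  2 / 3 <= expR eps / 6 + delta.
Proof.
move=> n4 alpha2.
have o (k : nat) (k4 : (k < 4)%N) : (k < n)%N by exact: leq_trans k4 n4.
pose v0 := Ordinal (o 0%N isT); pose v1 := Ordinal (o 1%N isT).
pose v2 := Ordinal (o 2%N isT); pose v3 := Ordinal (o 3%N isT).
(* A star with center [v1]; each edge added from [v0] to another leaf closes a triangle with the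
   center. *)
pose r0 := [rel u v : 'I_n | (u == v1) && (v \in [:: v0; v2; v3])].
pose r1 := [rel u v : 'I_n | r0 u v || ((u == v0) && (v == v2))].
pose r2 := [rel u v : 'I_n | r1 u v || ((u == v0) && (v == v3))].
pose G0 := graph_of r0; pose G1 := graph_of r1; pose G2 := graph_of r2.
have nb01 : edge_neighbors G1 G0.
  rewrite /edge_neighbors -(card1 (v0, v2)); apply: eq_card => -[u v].
  rewrite !inE /= xpair_eqE -!val_eqE /=.
  by case: u => [[|[|[|[|u]]]] ?]; case: v => [[|[|[|[|v]]]] ?]; rewrite /= ?andbF.
have nb12 : edge_neighbors G1 G2.
  rewrite /edge_neighbors -(card1 (v0, v3)); apply: eq_card => -[u v].
  rewrite !inE /= xpair_eqE -!val_eqE /=.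
  by case: u => [[|[|[|[|u]]]] ?]; case: v => [[|[|[|[|v]]]] ?]; rewrite /= ?andbF.
have lt01 : (triangles G0 < triangles G1)%N.
  apply: (@triangles_lt _ _ _ v0 v2 v1) => //=.
  by move=> i j /andP[->] /orP[]->; rewrite ?orbT.
have lt12 : (triangles G1 < triangles G2)%N.
  apply: (@triangles_lt _ _ _ v0 v3 v1) => //=.
  by move=> i j /andP[->] /orP[]->; rewrite ?orbT.
have gap k k' : (k < k')%N -> 2 * alpha < k'%:R - k%:R :> R.
  by rewrite -(ler_nat R) -natr1 => ?; lra.
pose E (i : graph n) := near_count (triangles i).
have mE i : measurable (E i) by exact: measurable_near_count.
have h0 : 2 / 3 <= law G0 (E G0) by exact: law_near_count.
have h1 : 2 / 3 <= law G1 (E G1) by exact: law_near_count.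
have h2 : 2 / 3 <= law G2 (E G2) by exact: law_near_count.
have s3 : law G1 (E G0) + law G1 (E G1) + law G1 (E G2) <= 1.
  rewrite -lawU//; last exact/near_count_disjoint/gap.
  apply: law_disjoint => //; first exact: measurableU.
  rewrite setIUl (near_count_disjoint (gap _ _ (ltn_trans lt01 lt12))).
  by rewrite (near_count_disjoint (gap _ _ lt12)) setU0.
have nbC (G G' : graph n) : edge_neighbors G G' -> edge_neighbors G' G.
  rewrite /edge_neighbors => <-; apply: eq_card => e; rewrite !inE; congr (_ && _).
  by rewrite eq_sym.
have k0 := law_ledp (mE G0) (nbC _ _ nb01).
have k2 := law_ledp (mE G2) (nbC _ _ nb12).
move: h0 h1 h2 s3 k0 k2 (expR_ge0 eps).
set P0 := law G0 _; set P1 := law G1 (E G1); set P2 := law G2 _.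
set Q0 := law G1 (E G0); set Q2 := law G1 (E G2); set e := expR eps.
move=> h0 h1 h2 s3 k0 k2 e0.
have : e * (Q0 + Q2) <= e * (1 / 3) by apply: ler_wpM2l => //; lra.
by lra.
Qed.

End estimator.
End laws.

(** * The group graphs against Bernoulli bits *)

Lemma prod_option_partition (R : comPzRingType) (V I : finType)
    (p : V -> option I) (f : V -> R) :
  \prod_v f v =
  \prod_(v | p v == None) f v * \prod_i \prod_(v | p v == Some i) f v.
Proof.
rewrite (partition_big p predT)//= (bigD1 None)//=; congr (_ * _).
rewrite (reindex_omap Some id) => [|[]//].
by apply: eq_big => // i; rewrite eqxx.
Qed.

Lemma measurable_prod_cond d (T : measurableType d) (R : realType) (I : finType)
    (P : pred I) (h : I -> T -> R) : (forall i, measurable_fun setT (h i)) ->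
  measurable_fun setT (fun t => \prod_(i | P i) h i t).
Proof.
by move=> mh; under eq_fun do rewrite -big_filter; exact: measurable_prod.
Qed.

Section bernoulli.
Context (R : realType) (N : nat) (eta : R).
Hypothesis eta01 : 0 <= eta <= 1.

Definition bernoulli_weight (x : {ffun 'I_N -> bool}) : R :=
  \prod_i (if x i then eta else 1 - eta).

Lemma bernoulli_weight_ge0 x : 0 <= bernoulli_weight x.
Proof.
have /andP[? ?] := eta01; apply: prodr_ge0 => i _.
by case: ifP => // _; rewrite subr_ge0.
Qed.

(** Expanding the product identifies the product of mixed factors with the average, over random
    bits, of the transcript densities. *)
Lemma prod_mixture (u v : 'I_N -> R) :
  \prod_i ((1 - eta) * u i + eta * v i) =
  \sum_x bernoulli_weight x * \prod_i (if x i then v i else u i).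
Proof.
transitivity (\prod_i \sum_(b : bool)
    (if b then eta * v i else (1 - eta) * u i)).
  by apply: eq_bigr => i _; rewrite big_bool addrC.
rewrite bigA_distr_bigA; apply: eq_bigr => x _.
by rewrite -big_split; apply: eq_bigr => i _; case: (x i).
Qed.

Lemma sum_bernoulli_weight : \sum_x bernoulli_weight x = 1.
Proof.
transitivity (\prod_(i < N) ((1 - eta) * 1 + eta * 1)).
  rewrite prod_mixture; apply: eq_bigr => x _.
  by rewrite big1 ?mulr1// => i _; case: (x i).
by rewrite big1// => i _; lra.
Qed.

(** Chernoff's bound with the moment [expR (- #ones)]: its mean is at most [expR (- N * eta / 2)]
    since [expR (-1) <= 1/2], and Markov's inequality gives back a factor [expR (N * eta / 4)]. *)
Lemma bernoulli_lower_tail :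
  \sum_(x : {ffun 'I_N -> bool} | #|[set i | x i]%SET|%:R < N%:R * eta / 4)
    bernoulli_weight x
  <= expR (- (N%:R * eta / 4)).
Proof.
have /andP[e0 e1] := eta01; set theta := N%:R * eta / 4.
have e2 : expR (-1) <= 1 / 2 :> R.
  rewrite expRN div1r lef_pV2 ?posrE ?expR_gt0//.
  by have := expR_ge1Dx (1 : R); lra.
apply: (@le_trans _ _ (\sum_(x : {ffun 'I_N -> bool}) bernoulli_weight x *
    (expR theta * \prod_i (if x i then expR (-1) else 1)))).
  rewrite big_mkcond; apply: ler_sum => x _.
  have prodE : \prod_i (if x i then expR (-1) else 1)
      = expR (- #|[set i | x i]%SET|%:R) :> R.
    rewrite -sum1_card natr_sum -sumrN expR_sum [RHS]big_mkcond/=.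
    by apply: eq_bigr => i _; rewrite inE.
  rewrite prodE -expRD; case: ifP => [lt|_]; last first.
    by rewrite mulr_ge0 ?bernoulli_weight_ge0 ?expR_ge0.
  rewrite ler_peMr ?bernoulli_weight_ge0//.
  by apply: le_trans (expR_ge1Dx _); rewrite lerDl subr_ge0 ltW.
have -> : \sum_(x : {ffun 'I_N -> bool}) bernoulli_weight x *
    (expR theta * \prod_i (if x i then expR (-1) else 1))
    = expR theta * \prod_(i < N) ((1 - eta) * 1 + eta * expR (-1)).
  by rewrite prod_mixture mulr_sumr; apply: eq_bigr => x _; rewrite mulrCA.
have h : \prod_(i < N) ((1 - eta) * 1 + eta * expR (-1)) <=
    \prod_(i < N) expR (- (eta / 2)).
  apply: ler_prod => i _; apply/andP; split.
    by rewrite addr_ge0 ?mulr_ge0 ?expR_ge0 ?subr_ge0.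
  apply: le_trans (expR_ge1Dx _).
  have : eta * expR (-1) <= eta * (1 / 2) by rewrite ler_wpM2l.
  by lra.
apply: (le_trans (ler_wpM2l (expR_ge0 _) h)).
rewrite -expR_sum -expRD ler_expR sumr_const card_ord -mulr_natl /theta.
by lra.
Qed.

End bernoulli.

(** * Testing the all-zero bits against random bits *)

Section core.
Context (R : realType) (n : nat) d (Y : measurableType d).
Variables (A : local_algorithm R n Y) (eps delta : R).
Hypotheses (A_halts : halts A) (A_ledp : LEDP eps delta A).
Hypotheses (eps0 : 0 <= eps) (delta0 : 0 <= delta).
Local Notation T := (transcript n Y).
Variables (est : T -> R) (alpha : R).
Hypothesis mest : measurable_fun setT est.
Hypothesis A_approx : approximates_triangles setT alpha A est.
Variables (N s : nat) (eta : R).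
Hypotheses (s0 : (0 < s)%N) (Nn : (N * s.*2 <= n)%N) (eta01 : 0 <= eta <= 1 / 2).
Hypothesis gap : forall m : nat, N%:R * eta / 4 <= m%:R ->
  2 * alpha < (m * s * s * (n - N * s.*2))%:R.

Let k : nat := s.*2 ^ 2.
Let B := expR (k%:R * eps).
Let delta' := k%:R * B * delta.
Local Notation GG := (@group_graph n N s).
Local Notation grp := (@group_of n N s).

(** The test event is an estimate near 0, the count of the all-zero graph, where it has probability
    at least 2/3. For bits with at least [N * eta / 4] ones, [gap] makes it disjoint from the
    accurate answers, leaving at most 1/3; fewer ones are covered by the Chernoff tail. *)
Lemma group_graph_bound :
  1 / 3 <= N%:R * (eta * delta' + eta ^+ 2 * (4 * (B - 1) ^+ 2 + 4 * delta'))
          + 7 / 9 * (1 / 3 + expR (- (N%:R * eta / 4))).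
Proof.
have [M [c [g [mc c0 mg g0 ME]]]] := transcript_law_density A.
have eta1 : 0 <= eta <= 1 by move: eta01 => /andP[? ?]; apply/andP; split; lra.
pose G0 := GG (fun=> false).
pose a i t := \prod_(v | grp v == Some i) g v (adj_row (GG (fun=> false)) v) t.
pose b i t := \prod_(v | grp v == Some i) g v (adj_row (GG (fun=> true)) v) t.
pose w t := c t * \prod_(v | grp v == None) g v (adj_row G0 v) t.
have ma i : measurable_fun setT (a i) by exact: measurable_prod_cond.
have mb i : measurable_fun setT (b i) by exact: measurable_prod_cond.
have mw : measurable_fun setT w.
  by apply: measurable_funM => //; exact: measurable_prod_cond.
have a0 i t : 0 <= a i t by exact: prodr_ge0.
have b0 i t : 0 <= b i t by exact: prodr_ge0.
have w0 t : 0 <= w t by rewrite mulr_ge0// prodr_ge0.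
pose dens (x : 'I_N -> bool) t := w t * \prod_i (if x i then b i t else a i t).
have densE x t : c t * \prod_v g v (adj_row (GG x) v) t = dens x t.
  rewrite (prod_option_partition grp) mulrA; congr (_ * _).
    congr (_ * _); apply: eq_bigr => v /eqP vN.
    by rewrite (adj_row_no_group _ (fun=> false)).
  apply: eq_bigr => i _; rewrite /a /b; case xi: (x i);
    by apply: eq_bigr => v /eqP vi; rewrite (adj_row_group _ vi) xi.
have dens_ge0 x t : 0 <= dens x t.
  by rewrite mulr_ge0//; apply: prodr_ge0 => i _; case: ifP.
have mdens x : measurable_fun setT (dens x).
  apply: measurable_funM => //; apply: measurable_prod => i _.
  by case: (x i).
have intdens x E : measurable E ->
    (\int[M]_(t in E) (dens x t)%:E = (law A (GG x) E)%:E)%E.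
  move=> mE; rewrite -lawE// ME//; apply: eq_integral => t _.
  by rewrite -densE.
have lawT x : law A (GG x) setT = 1 by rewrite /law A_halts.
have Rdens x E : measurable E -> \int[M]_(t in E) dens x t = law A (GG x) E.
  by move=> mE; rewrite /Rintegral intdens.
have idens x : M.-integrable setT (EFin \o dens x).
  by apply: ge0_integrable => //; rewrite intdens// ltry.
have q_dens i t : w t * (b i t * \prod_(j | j != i) a j t) = dens (pred1 i) t.
  congr (_ * _); rewrite [RHS](bigD1 i)//= eqxx; congr (_ * _).
  by apply: eq_bigr => j /negbTE ->.
pose W := @bernoulli_weight R N eta.
have W0 x : 0 <= W x by exact: bernoulli_weight_ge0.
have p1_dens t : w t * \prod_i ((1 - eta) * a i t + eta * b i t) =
    \sum_x W x * dens x t.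
  by rewrite prod_mixture mulr_sumr; apply: eq_bigr => x _; rewrite mulrCA.
have Rp1 E : measurable E -> \int[M]_(t in E) (\sum_x W x * dens x t) =
    \sum_x W x * law A (GG x) E.
  move=> mE; rewrite -Rintegral_mul_indic.
  have int1 (x : {ffun 'I_N -> bool}) := integrable_mul_indic mE (idens x).
  have int2 x := integrableZl measurableT (W x) (int1 x).
  have [_ H] := Rintegral_sum (index_enum {ffun 'I_N -> bool}) int2.
  under eq_Rintegral do rewrite mulr_suml.
  under eq_Rintegral => t _ do under eq_bigr => x _ do rewrite -mulrA.
  rewrite H; apply: eq_bigr => x _.
  by rewrite RintegralZl// Rintegral_mul_indic Rdens.
have ip1 : M.-integrable setT (EFin \o (fun t => \sum_x W x * dens x t)).
  have int2 (x : {ffun 'I_N -> bool}) :=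
    integrableZl measurableT (W x) (idens x).
  by have [] := Rintegral_sum (index_enum {ffun 'I_N -> bool}) int2.
have B1 : 1 <= B.
  by apply: le_trans (expR_ge1Dx _); rewrite lerDl mulr_ge0.
have dist i : (edge_dist (GG (fun=> false)) (GG (pred1 i)) <= k)%N.
  exact: edge_dist_group_graph.
have dist' i : (edge_dist (GG (pred1 i)) (GG (fun=> false)) <= k)%N.
  rewrite (leq_trans _ (dist i))// leq_eqVlt; apply/orP; left; apply/eqP.
  by apply: eq_card => e; rewrite !inE; congr (_ && _); rewrite eq_sym.
pose E0 := near_count est alpha (triangles G0).
have mE0 : measurable E0 by exact: measurable_near_count.
have intp : (\int[M]_t (w t * \prod_i a i t)%:E = 1)%E.
  by rewrite -[RHS](congr1 EFin (lawT (fun=> false))) -intdens.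
have intq i : (\int[M]_t (w t * (b i t * \prod_(j | j != i) a j t))%:E = 1)%E.
  under eq_integral do rewrite q_dens.
  by rewrite intdens// lawT.
have intp1 : (\int[M]_t (w t * \prod_i ((1 - eta) * a i t + eta * b i t))%:E = 1)%E.
  under eq_integral do rewrite p1_dens.
  rewrite -[LHS]fineK; last exact: integrable_fin_num.
  congr EFin; rewrite [LHS](Rp1 _ measurableT).
  under eq_bigr do rewrite lawT mulr1.
  exact: sum_bernoulli_weight.
have RpE E : measurable E ->
    \int[M]_(t in E) (w t * \prod_i a i t) = law A G0 E.
  by move=> mE; rewrite -(Rdens (fun=> false) _ mE).
have RqE i E : measurable E ->
    \int[M]_(t in E) (w t * (b i t * \prod_(j | j != i) a j t)) =
    law A (GG (pred1 i)) E.
  by move=> mE; rewrite -(Rdens _ _ mE); apply: eq_Rintegral => t _; rewrite q_dens.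
have pq i E : measurable E -> \int[M]_(t in E) (w t * \prod_i a i t) <=
    B * \int[M]_(t in E) (w t * (b i t * \prod_(j | j != i) a j t)) + delta'.
  by move=> mE; rewrite RpE// RqE//; exact: group_privacy.
have qp i E : measurable E ->
    \int[M]_(t in E) (w t * (b i t * \prod_(j | j != i) a j t)) <=
    B * \int[M]_(t in E) (w t * \prod_i a i t) + delta'.
  by move=> mE; rewrite RpE// RqE//; exact: group_privacy.
have E0_large : 2 / 3 <= \int[M]_(t in E0) (w t * \prod_i a i t).
  by rewrite RpE//; exact: law_near_count.
apply: le_trans (divergence_bound mw w0 ma a0 mb b0 eta01 B1 intp intq intp1
  pq qp mE0 E0_large) _.
rewrite lerD2l ler_wpM2l//.
under eq_Rintegral do rewrite p1_dens.
rewrite Rp1//.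
apply: le_trans (lerD (lexx (1 / 3)) (bernoulli_lower_tail N eta1)).
have third : 1 / 3 = \sum_(x : {ffun 'I_N -> bool}) 1 / 3 * W x.
  by rewrite -mulr_sumr sum_bernoulli_weight mulr1.
rewrite [X in _ <= X + _]third [X in _ <= _ + X]big_mkcond -big_split.
apply: ler_sum => x _ /=.
rewrite -/(W x); case: ltP => [_|ge_x].
  rewrite -[X in _ + X]mul1r -mulrDl mulrC; apply: ler_wpM2r => //.
  by apply: le_trans (law_le1 A_halts (GG x) mE0) _; rewrite lerDr.
rewrite addr0 mulrC; apply: ler_wpM2r => //.
have gapx := gap ge_x.
have dis : E0 `&` near_count est alpha (triangles (GG x)) = set0.
  apply: near_count_disjoint; rewrite /G0 triangles_group_graph0 subr0.
  by apply: lt_le_trans gapx _; rewrite ler_nat; exact: triangles_group_graph.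
have mEx : measurable (near_count est alpha (triangles (GG x))).
  exact: measurable_near_count.
have h1 := law_disjoint A_halts (GG x) mE0 mEx dis.
have h2 := law_near_count A_halts mest A_approx (GG x).
by move: h1 h2; set P := law _ _ _; set Q := law _ _ _ => h1 h2; lra.
Qed.


End core.

(** * Choice of the constants *)

Section real_bounds.
Context (R : realType).

Lemma expR_sub1_le (x : R) : expR x - 1 <= x * expR x.
Proof.
have := expR_ge1Dx (- x); rewrite expRN => h.
have := ler_wpM2r (expR_ge0 x) h; rewrite mulVf ?gt_eqF ?expR_gt0//.
by lra.
Qed.

Lemma expRN_le (x : R) : 0 <= x -> expR (- x) * (1 + x) <= 1.
Proof.
move=> x0; have := ler_wpM2l (expR_ge0 (- x)) (expR_ge1Dx x).
by rewrite expRN mulVf ?gt_eqF ?expR_gt0.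
Qed.

(** The argument of the logarithm is at least [n >= 15], so the logarithm is at least 1/2 and the
    factor [1 / 10^5] absorbs its inverse. *)
Lemma delta_bound (eps alpha delta : R) (n : nat) :
  0 < eps < 1 -> (15 <= n)%N -> 0 < alpha <= n%:R ^+ 2 ->
  delta <= 1 / 10 ^+ 5 *
      (eps ^+ 3 * alpha ^+ 2 / (n%:R ^+ 5 * ln (n%:R ^+ 3 / (eps * alpha)))) ->
  delta * n%:R ^+ 5 <= eps ^+ 3 * alpha ^+ 2.
Proof.
move=> /andP[e0 e1] n15 /andP[a0 an] dle.
have n15R : 15 <= n%:R :> R by rewrite (ler_nat R 15).
set nR : R := n%:R in n15R an dle *.
have n0 : 0 < nR by apply: lt_le_trans n15R.
set X := nR ^+ 3 / (eps * alpha) in dle.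
have X15 : 15 <= X.
  apply: le_trans n15R _; rewrite ler_pdivlMr ?mulr_gt0//.
  have -> : nR ^+ 3 = nR * nR ^+ 2 by rewrite exprS.
  rewrite ler_pM2l//; apply: le_trans an.
  by rewrite ler_piMl// ltW.
have X0 : 0 < X by apply: lt_le_trans X15.
have l12 : 1 / 2 <= ln X.
  have : ln (1 + (X^-1 - 1)) <= X^-1 - 1.
    by apply: le_ln1Dx; rewrite ltrBrDr addNr invr_gt0.
  rewrite subrKC lnV ?posrE//.
  have : X^-1 <= 15^-1 by rewrite lef_pV2 ?posrE.
  by lra.
set l := ln X in dle l12.
have l0 : 0 < l by apply: lt_le_trans l12.
have n5 : 0 < nR ^+ 5 by rewrite exprn_gt0.
set Z := eps ^+ 3 * alpha ^+ 2 in dle *.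
have Z0 : 0 <= Z by rewrite mulr_ge0// exprn_ge0// ltW.
have lV : l^-1 <= 2.
  have -> : 2 = (1 / 2)^-1 :> R by lra.
  by rewrite lef_pV2 ?posrE//.
have lV0 : 0 <= l^-1 by rewrite invr_ge0 ltW.
rewrite -ler_pdivlMr//; apply: le_trans dle _.
have W0 : 0 <= Z / nR ^+ 5 by rewrite divr_ge0// ltW.
have -> : Z / (nR ^+ 5 * l) = Z / nR ^+ 5 * l^-1 by rewrite invfM mulrA.
set W := Z / nR ^+ 5 in W0 *.
have : W * l^-1 <= W * 2 by rewrite ler_wpM2l.
by lra.
Qed.

End real_bounds.

(** * Large [n]: parameters of the hard instances *)

Section large.
Context (R : realType) (n : nat) d (Y : measurableType d).
Variables (A : local_algorithm R n Y) (eps alpha delta : R).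
Hypotheses (A_halts : halts A) (A_ledp : LEDP eps delta A).
Hypotheses (eps0 : 0 < eps) (eps1 : eps < 1) (delta0 : 0 <= delta).
Variable est : transcript n Y -> R.
Hypothesis mest : measurable_fun setT est.
Hypothesis A_approx : approximates_triangles setT alpha A est.
Hypotheses (alpha0 : 0 < alpha) (alphan : alpha <= n%:R ^+ 2).
Hypothesis delta_le : delta * n%:R ^+ 5 <= eps ^+ 3 * alpha ^+ 2.
(* [s] is 200; it is kept abstract to prevent the computation of [k] in unary. *)
Variables (s : nat) (r : R).
Hypotheses (s200 : s%:R = 200 :> R) (r0 : 0 < r) (rn : r ^+ 2 = n%:R).

Let k : nat := s.*2 ^ 2.
Let L : R := k%:R * expR k%:R.
Hypothesis r_large : 20 * (20 * (10 * (100 * L))) <= r.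

Lemma large_case : r ^+ 3 <= L * (alpha * eps).
Proof.
rewrite leNgt; apply/negP => alpha_small.
have s0 : (0 < s)%N by rewrite -(ltr_nat R) s200; lra.
have k1 : 1 <= k%:R :> R by rewrite (ler_nat R 1) expn_gt0 double_gt0 s0.
have L1 : 1 <= L.
  have : 1 <= expR k%:R :> R by apply: le_trans (expR_ge1Dx _); lra.
  by move=> ?; rewrite /L mulr_ege1.
have L0 : 0 < L by apply: lt_le_trans L1.
pose K := L^-1.
have KL : K * L = 1 by rewrite mulVf// gt_eqF.
have K0 : 0 < K by rewrite invr_gt0.
have K1 : K <= 1 by rewrite invf_le1.
have r1 : 100 <= r by apply: le_trans r_large; lra.
(* The floor [K / r] keeps [eta] at most 1/2. Both branches give [alpha * e <= K * r^3]: by the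
   assumption being refuted when [e] is [eps], and by [alpha <= n^2 = r^4] when [e] is [K / r]. *)
pose e := Num.max eps (K / r).
have eps_e : eps <= e by rewrite le_max lexx.
have e0 : 0 < e by apply: lt_le_trans eps_e.
have er : K <= e * r by rewrite -ler_pdivrMr// le_max lexx orbT.
have e1 : e < 1.
  by rewrite gt_max eps1 ltr_pdivrMr// mul1r; apply: le_lt_trans K1 _; lra.
have alpha_e : alpha * e <= K * r ^+ 3.
  rewrite /e; case: (leP eps (K / r)) => _.
    have -> : K * r ^+ 3 = r ^+ 2 * (K * r) by lra.
    rewrite rn; apply: (@le_trans _ _ (n%:R ^+ 2 * (K / r))).
      by rewrite ler_wpM2r// divr_ge0// ltW.
    rewrite -rn; have -> : (r ^+ 2) ^+ 2 * (K / r) = r ^+ 2 * (K * r) * (r / r).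
      by set v := r^-1; lra.
    by rewrite divff ?mulr1// gt_eqF.
  rewrite -[leLHS]mul1r -KL -mulrA; rewrite ler_pM2l//.
  exact: ltW.
have A_ledp' : LEDP e delta A.
  move=> G G' GG' E mE; apply: le_trans (A_ledp GG' mE) _.
  rewrite (lawE A_halts G' mE) -!EFinM -!EFinD lee_fin lerD2r.
  by apply: ler_wpM2r; [exact: law_ge0|rewrite ler_expR].
have d4 : delta * r ^+ 4 <= e * K ^+ 2.
  have r6 : 0 < r ^+ 6 by rewrite exprn_gt0.
  rewrite -(ler_pM2r r6).
  have -> : delta * r ^+ 4 * r ^+ 6 = delta * (r ^+ 2) ^+ 5 by lra.
  rewrite rn; apply: le_trans delta_le _.
  have -> : e * K ^+ 2 * r ^+ 6 = e * (K * r ^+ 3) ^+ 2 by lra.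
  apply: (@le_trans _ _ (e * (alpha * e) ^+ 2)).
    have -> : e * (alpha * e) ^+ 2 = e ^+ 3 * alpha ^+ 2 by lra.
    by rewrite ler_wpM2r ?sqr_ge0// lerXn2r// nnegrE ltW.
  rewrite ler_pM2l//; apply: lerXn2r => //; rewrite nnegrE.
    by rewrite mulr_ge0 ?ltW.
  by rewrite mulr_ge0 ?exprn_ge0 ?ltW.
(* Groups have [2 * s] nodes, so they fill at most half of the graph. Here [4 * s = 800]; the 1000
   in [N_ge] leaves room for rounding, as [n >= 10^4]. *)
pose N := (n %/ (4 * s))%N.
have N_le : N%:R * (8 * 100) <= r ^+ 2.
  rewrite rn; have := leq_trunc_div n (4 * s).
  by rewrite -(ler_nat R) !natrM s200; lra.
have N_ge : r ^+ 2 <= N%:R * (10 * 100).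
  have r2 : 100 * 100 <= r ^+ 2.
    by have := ler_wpM2r (ltW r0) r1; rewrite -expr2; lra.
  have : (n < N.+1 * (4 * s))%N by rewrite ltn_ceil// muln_gt0 s0.
  rewrite -(ltr_nat R) -rn !natrM s200 -natr1; lra.
have Nn : (N * s.*2 <= n)%N.
  apply: leq_trans (leq_trunc_div n (4 * s)).
  by rewrite leq_mul2l -muln2 mulnC leq_mul2r orbT orbT.
(* Makes [eta * e * r = K / 2]; with [N <= r^2 / 800] and [K * L = 1], the entropy term
   [4 * N * eta^2 * (L * e)^2] is then at most 1/800. *)
pose eta := K / (2 * (e * r)).
have er0 : 0 < e * r by rewrite mulr_gt0.
have eta_er : eta * (e * r) = K / 2.
  by rewrite /eta; set E := e * r; rewrite invfM [K * _]mulrA divfK// gt_eqF.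
have eta0 : 0 < eta by rewrite divr_gt0// mulr_gt0.
have eta2 : eta <= 1 / 2.
  by rewrite -(ler_pM2r er0) eta_er; lra.
have eta01 : 0 <= eta <= 1 / 2 by rewrite ltW.
have alpha_eta : alpha <= 2 * (eta * r ^+ 4).
  rewrite -(ler_pM2r e0); apply: le_trans alpha_e _.
  have -> : 2 * (eta * r ^+ 4) * e = 2 * (eta * (e * r)) * r ^+ 3 by lra.
  by rewrite eta_er; lra.
(* Here [s = 200] is large enough: [m >= r^2 * eta / 4000], [s^2 = 40000] and at least [r^2 / 2]
   outside nodes give [5 * eta * r^4] triangles, against [2 * alpha <= 4 * eta * r^4]. *)
have gap m : N%:R * eta / 4 <= m%:R ->
    2 * alpha < (m * s * s * (n - N * s.*2))%:R.
  move=> hm; rewrite !natrM natrB// natrM -muln2 natrM s200 -rn.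
  have r2 : r ^+ 2 / 2 <= r ^+ 2 - N%:R * (200 * 2) by lra.
  have r20 : 0 <= r ^+ 2 / 2 by rewrite divr_ge0// sqr_ge0.
  have m1 : r ^+ 2 * eta / (40 * 100) <= m%:R.
    have := ler_wpM2r (ltW eta0) N_ge; lra.
  have m0 : 0 <= r ^+ 2 * eta / (40 * 100).
    by rewrite divr_ge0// mulr_ge0 ?sqr_ge0// ltW.
  have := ler_pM m0 r20 m1 r2.
  have -> : r ^+ 2 * eta / (40 * 100) * (r ^+ 2 / 2) = eta * r ^+ 4 / (80 * 100) by lra.
  have r4 : 0 < eta * r ^+ 4 by rewrite mulr_gt0// exprn_gt0.
  by lra.
have := group_graph_bound A_halts A_ledp' (ltW e0) delta0 mest A_approx
  s0 Nn eta01 gap.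
rewrite -/k; set B := expR (k%:R * e); set d' := k%:R * B * delta.
have B_le : B <= expR k%:R by rewrite ler_expR ler_piMr// ltW.
have B0 : 0 < B by exact: expR_gt0.
have B1 : 1 <= B.
  by apply: le_trans (expR_ge1Dx _); rewrite lerDl mulr_ge0// ltW.
have B1_le : B - 1 <= L * e.
  apply: le_trans (expR_sub1_le _) _; rewrite -/B /L mulrAC.
  by apply: ler_wpM2r; [exact: ltW|apply: ler_wpM2l].
have d'_le : d' <= L * delta.
  by apply: ler_wpM2r => //; apply: ler_wpM2l.
have d'0 : 0 <= d' by rewrite !mulr_ge0// ltW.
have N0 : 0 <= N%:R :> R by [].
have T1 : N%:R * (eta ^+ 2 * (4 * (B - 1) ^+ 2)) <= 1 / (8 * 100).
  apply: (@le_trans _ _ (N%:R * (eta ^+ 2 * (4 * (L * e) ^+ 2)))).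
    apply: ler_wpM2l => //; apply: ler_wpM2l; first exact: sqr_ge0.
    by rewrite ler_pM2l// lerXn2r// nnegrE ?subr_ge0// mulr_ge0// ltW.
  have -> : N%:R * (eta ^+ 2 * (4 * (L * e) ^+ 2)) =
    N%:R * (8 * 100) * (eta ^+ 2 * (L * e) ^+ 2 / 200) by lra.
  apply: (@le_trans _ _ (r ^+ 2 * (eta ^+ 2 * (L * e) ^+ 2 / 200))).
    apply: (ler_wpM2r _ N_le); apply: divr_ge0; last by lra.
    by apply: mulr_ge0; exact: sqr_ge0.
  have -> : r ^+ 2 * (eta ^+ 2 * (L * e) ^+ 2 / 200) =
    (eta * (e * r)) ^+ 2 * L ^+ 2 / 200 by lra.
  have -> : (eta * (e * r)) ^+ 2 * L ^+ 2 / 200 = (K * L) ^+ 2 / (8 * 100).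
    by rewrite eta_er; lra.
  by rewrite KL expr1n.
(* [N * eta * L] is at most [r / (1600 * e)], while [d4] bounds [delta] by [e * K^2 / r^4]. *)
have T2 : N%:R * (eta * d' + eta ^+ 2 * (4 * d')) <= 3 / (16 * 100).
  have h1 : eta * d' + eta ^+ 2 * (4 * d') <= 3 * (eta * (L * delta)).
    have : eta * d' <= eta * (L * delta) by rewrite ler_pM2l.
    have : eta * (eta * d') <= 1 / 2 * (eta * d').
      by rewrite ler_wpM2r// mulr_ge0// ltW.
    by lra.
  apply: (@le_trans _ _ (N%:R * (3 * (eta * (L * delta))))).
    exact: ler_wpM2l.
  have p0 : 0 <= eta * (L * delta).
    by apply: mulr_ge0; [exact: ltW|apply: mulr_ge0 => //; exact: ltW].
  apply: (@le_trans _ _ (3 / (8 * 100) * (r ^+ 2 * (eta * (L * delta))))).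
    by have := ler_wpM2r p0 N_le; lra.
  suff : r ^+ 2 * (eta * (L * delta)) <= 1 / 2 by lra.
  have er3 : 0 < e * r ^+ 3 by rewrite mulr_gt0// exprn_gt0.
  rewrite -(ler_pM2r er3).
  have -> : r ^+ 2 * (eta * (L * delta)) * (e * r ^+ 3) =
    L * (eta * (e * r)) * (delta * r ^+ 4) by lra.
  rewrite eta_er; apply: (@le_trans _ _ (L * (K / 2) * (e * K ^+ 2))).
    by apply: ler_wpM2l => //; rewrite !mulr_ge0// ltW.
  have -> : L * (K / 2) * (e * K ^+ 2) = (K * L) / 2 * (e * K ^+ 2) by lra.
  rewrite KL; apply: ler_wpM2l; first by lra.
  rewrite ler_pM2l//; apply: (@le_trans _ _ 1); first by rewrite expr_le1// ltW.
  by rewrite exprn_ege1//; lra.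
set X := N%:R * eta / 4.
(* The threshold [400000 * L] in [r_large] comes from here: [X >= r^2 * eta / 4000], and
   [r^2 * eta * e = r * K / 2 >= 200000] with [e < 1]. *)
have X50 : 50 <= X.
  have h : r ^+ 2 * eta <= N%:R * (10 * 100) * eta by rewrite ler_pM2r.
  suff : 20 * (10 * (10 * 100)) <= r ^+ 2 * eta by rewrite /X; lra.
  have h2 : 20 * (20 * (10 * 100)) <= r * K.
    have := ler_wpM2r (ltW K0) r_large; have : L * K = 1 by rewrite mulrC.
    by lra.
  rewrite -(ler_pM2r e0).
  have -> : r ^+ 2 * eta * e = r * (eta * (e * r)) by lra.
  rewrite eta_er; lra.
have E51 : expR (- X) <= 1 / 51.
  have X0 : 0 <= X by apply: le_trans X50.
  have := expRN_le X0; have := ler_wpM2l (expR_ge0 (- X)) X50.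
  by lra.
have -> : N%:R * (eta * d' + eta ^+ 2 * (4 * (B - 1) ^+ 2 + 4 * d')) =
  N%:R * (eta ^+ 2 * (4 * (B - 1) ^+ 2)) +
  N%:R * (eta * d' + eta ^+ 2 * (4 * d')) by lra.
(* The right-hand side is at most [1/800 + 3/1600 + 7/9 * (1/3 + 1/51)], about 0.278, which is below
   1/3. *)
move: T1 T2 E51; set U := N%:R * _; set V := N%:R * _; set Z := expR _.
by lra.
Qed.

End large.

(** * Crude bounds on [eps] and [alpha], sufficient for bounded [n] *)

Section small.
Context (R : realType) (n : nat) d (Y : measurableType d).
Variables (A : local_algorithm R n Y) (eps alpha delta : R).
Hypotheses (A_halts : halts A) (A_ledp : LEDP eps delta A).
Hypotheses (eps0 : 0 < eps) (eps1 : eps < 1) (delta0 : 0 <= delta).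
Variable est : transcript n Y -> R.
Hypothesis mest : measurable_fun setT est.
Hypothesis A_approx : approximates_triangles setT alpha A est.
Hypotheses (alpha0 : 0 < alpha) (alphan : alpha <= n%:R ^+ 2).
Hypothesis delta_le : delta * n%:R ^+ 5 <= eps ^+ 3 * alpha ^+ 2.
Hypothesis n15 : (15 <= n)%N.

Lemma eps_lower_bound : 1 / 20 <= n%:R ^+ 2 * eps.
Proof.
rewrite leNgt; apply/negP => small.
have n1 : 1 <= n%:R :> R by rewrite (ler_nat R 1); exact: leq_trans n15.
have := complete_empty_bound A_halts A_ledp (ltW eps0) delta0 mest A_approx
  n15 alphan.
rewrite natrX; move: alphan delta_le small n1.
set v : R := n%:R => alpha_v delta_v small n1.
have v0 : 0 < v by apply: lt_le_trans n1.
set x := v ^+ 2 * eps in small *.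
have x0 : 0 <= x by rewrite mulr_ge0 ?sqr_ge0 ?ltW.
have ex : expR x <= 20 / 19.
  have h := expRN_le x0; rewrite expRN in h.
  have := expR_sub1_le x; have := ler_wpM2l (expR_ge0 x) (ltW small).
  by lra.
have deps : delta <= eps.
  have v4 : 0 < v ^+ 4 by rewrite exprn_gt0.
  rewrite -(ler_pM2r v4); apply: (@le_trans _ _ (delta * v ^+ 5)).
    apply: ler_wpM2l => //; rewrite [leRHS]exprSr.
    by apply: ler_peMr => //; exact: ltW.
  apply: le_trans delta_v _.
  apply: ler_pM; [exact/exprn_ge0/ltW|exact: sqr_ge0| |].
    by rewrite exprS ger_pMr//; apply/ltW/exprn_ilt1 => //; exact: ltW.
  have -> : v ^+ 4 = (v ^+ 2) ^+ 2 by rewrite -exprM.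
  by apply: lerXn2r => //; rewrite nnegrE ?sqr_ge0 ?ltW.
have vd : v ^+ 2 * delta <= 1 / 20.
  apply: (@le_trans _ _ x); last exact: ltW.
  by apply: ler_wpM2l => //; exact: sqr_ge0.
have := ler_wpM2l (expR_ge0 x) vd.
set E := expR x in ex *; set D := v ^+ 2 * delta.
have -> : v ^+ 2 * E * delta = E * D by rewrite /D; lra.
by lra.
Qed.

Lemma alpha_lower_bound : 1 / 2 <= alpha.
Proof.
rewrite leNgt; apply/negP => small.
have n15R : 15 <= n%:R :> R by rewrite (ler_nat R 15).
have n4 : (4 <= n)%N by exact: leq_trans n15.
have := three_graphs_bound A_halts A_ledp mest A_approx n4 small.
move: delta_le n15R; set v : R := n%:R => delta_v n15R.
have e4 : expR eps <= 256 / 81.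
  have q : expR (1 / 4) <= 4 / 3 :> R.
    by have := expR_sub1_le (1 / 4 : R); lra.
  have q2 : expR (1 / 4) * expR (1 / 4) <= 4 / 3 * (4 / 3) :> R.
    by apply: ler_pM => //; exact: expR_ge0.
  apply: (@le_trans _ _ (expR (1 / 4 + 1 / 4 + (1 / 4 + 1 / 4)))).
    by rewrite ler_expR; apply: le_trans (ltW eps1) _; lra.
  rewrite !expRD; apply: (@le_trans _ _ (4 / 3 * (4 / 3) * (4 / 3 * (4 / 3)))).
    by apply: ler_pM => //; rewrite mulr_ge0 ?expR_ge0.
  by lra.
have d60 : delta <= 1 / 60.
  have v5 : 15 <= v ^+ 5.
    have v1 : 0 <= v by lra.
    apply: (le_trans n15R); rewrite exprS; apply: ler_peMr => //.
    by apply: exprn_ege1; lra.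
  have h1 : delta * 15 <= delta * v ^+ 5 by apply: ler_wpM2l.
  have h2 : eps ^+ 3 * alpha ^+ 2 <= 1 * (1 / 2) ^+ 2.
    apply: ler_pM; [exact/exprn_ge0/ltW|exact: sqr_ge0| |].
      by apply/ltW/exprn_ilt1 => //; exact: ltW.
    by apply: lerXn2r => //; rewrite ?nnegrE ?ltW//; lra.
  by lra.
by lra.
Qed.

End small.

(** For [1 <= n <= 14] the constant answer ['C(n, 3) / 2] is within [n^2] of every count and
    perfectly private, so at [alpha = n^2] no lower bound growing like [1 / eps] can hold. *)
Theorem theorem1p3 (R : realType) :
  exists (F : forall n : nat, set (graph n)) (c : R), 0 < c /\
  forall (eps : R) (n : nat) (alpha delta : R),
    0 < eps < 1 ->
    (15 <= n)%N ->
    0 < alpha <= n%:R ^+ 2 ->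
    0 <= delta <= 1 / 10 ^+ 5 *
      (eps ^+ 3 * alpha ^+ 2 / (n%:R ^+ 5 * ln (n%:R ^+ 3 / (eps * alpha)))) ->
  forall (d : measure_display) (Y : measurableType d)
    (A : local_algorithm R n Y) (est : transcript n Y -> R),
    measurable_fun setT est ->
    halts A ->
    LEDP eps delta A ->
    approximates_triangles (F n) alpha A est ->
    c * (n%:R `^ (3 / 2) / eps) <= alpha.
Proof.
have [s s200] : exists s : nat, s%:R = 200 :> R by exists 200%N.
pose L : R := (s.*2 ^ 2)%:R * expR (s.*2 ^ 2)%:R.
have L1 : 1 <= L.
  have s0 : (0 < s)%N by rewrite -(ltr_nat R) s200; lra.
  have k1 : 1 <= (s.*2 ^ 2)%:R :> R.
    by rewrite (ler_nat R 1) expn_gt0 double_gt0 s0.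
  by rewrite mulr_ege1//; apply: le_trans (expR_ge1Dx _); lra.
pose Q := 20 * (20 * (10 * (100 * L))).
have LQ : L <= Q by rewrite /Q; lra.
have Q1 : 1 <= Q by apply: le_trans LQ.
have Q0 : 0 < Q by apply: lt_le_trans Q1.
(* For [r < Q] the bounds [alpha >= 1/2] and [eps >= 1 / (20 * r^4)] must imply
   [c * r^3 <= alpha * eps], which gives [40 * Q^3 * Q^4]. For [r >= Q] only [c * L <= 1] is
   required. *)
pose c := (40 * Q ^+ 7)^-1.
have Q7 : 0 < 40 * Q ^+ 7 by rewrite mulr_gt0// exprn_gt0.
have c0 : 0 < c by rewrite invr_gt0.
have cQ : c * (40 * Q ^+ 7) = 1 by rewrite mulVf// gt_eqF.
have cL : c * L <= 1.
  rewrite -cQ; apply: ler_wpM2l; first exact: ltW.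
  apply: le_trans LQ _; rewrite exprS.
  have : 1 * Q <= Q ^+ 6 * Q by rewrite ler_pM2r// exprn_ege1.
  by lra.
exists (fun=> setT), c; split => // eps n alpha delta eps01 n15 alpha_n /andP[d0 dle].
move=> d Y A est mest A_halts A_ledp A_approx.
have delta_le := delta_bound eps01 n15 alpha_n dle.
have /andP[e0 e1] := eps01; have /andP[a0 an] := alpha_n.
pose r : R := Num.sqrt n%:R.
have n0 : 0 < n%:R :> R by rewrite ltr0n; exact: leq_trans n15.
have r0 : 0 < r by rewrite sqrtr_gt0.
have rn : r ^+ 2 = n%:R by rewrite sqr_sqrtr// ltW.
have -> : n%:R `^ (3 / 2) = r ^+ 3 :> R.
  have -> : 3 / 2 = 2^-1 * 3%:R :> R by lra.
  by rewrite powRrM powR12_sqrt ?ltW// powR_mulrn// sqrtr_ge0.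
have r30 : 0 < r ^+ 3 by rewrite exprn_gt0.
rewrite mulrA ler_pdivrMr//.
have [Qr|rQ] := leP Q r.
  have := large_case A_halts A_ledp e0 e1 d0 mest A_approx a0 an delta_le
    s200 r0 rn Qr.
  rewrite -/L => /(ler_wpM2l (ltW c0)) /le_trans; apply.
  rewrite [leLHS]mulrA -[leRHS]mul1r. apply: ler_wpM2r => //.
  by rewrite mulr_ge0 ?ltW.
have a2 := alpha_lower_bound A_halts A_ledp e0 e1 d0 mest A_approx a0 delta_le n15.
have e20 := eps_lower_bound A_halts A_ledp e0 e1 d0 mest A_approx a0 an delta_le n15.
rewrite -rn in e20.
have h1 : r ^+ 4 * eps <= Q ^+ 4 * eps.
  by rewrite ler_pM2r//; apply: lerXn2r; rewrite ?nnegrE ?ltW.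
have h3 : r ^+ 3 <= Q ^+ 3 by apply: lerXn2r; rewrite ?nnegrE ltW.
have cQ3 : c * r ^+ 3 <= c * Q ^+ 3 by rewrite ler_pM2l.
have h4 : c * Q ^+ 3 * (1 / 20) <= c * Q ^+ 3 * (Q ^+ 4 * eps).
  apply: ler_wpM2l; first by rewrite mulr_ge0 ?exprn_ge0 ?ltW.
  by apply: le_trans h1; rewrite (_ : r ^+ 4 = (r ^+ 2) ^+ 2)// -exprM.
have h5 : c * Q ^+ 3 * (Q ^+ 4 * eps) * 40 = eps.
  have -> : c * Q ^+ 3 * (Q ^+ 4 * eps) * 40 = c * (40 * Q ^+ 7) * eps by lra.
  by rewrite cQ mul1r.
have h6 : 1 / 2 * eps <= alpha * eps by rewrite ler_pM2r.
by lra.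
Qed.
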